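(* Let $G$ be a connected simply-connected simple complex Lie group with Lie algebra $\mathfrak g$, and fix a compact real form $\mathfrak k\subset\mathfrak g$. Let $\mathcal{O}\subset\mathfrak g$ be a nonzero nilpotent adjoint orbit. Then $\mathcal{O}$ is a Moore–Penrose orbit if and only if $\mathrm{ht}(\mathcal{O})=2$. In this case, for every $e\in\mathcal{O}$ there is a unique $\mathfrak{sl}_2$-triple $\langle e,h,f\rangle$ with $h\in i\mathfrak k$.
   Context: An $\mathfrak{sl}_2$-triple is $(e,h,f)$ with $[e,f]=h$, $[h,e]=2e$, $[h,f]=-2f$. A nilpotent orbit $\mathcal{O}$ is a Moore–Penrose orbit if for every $e\in\mathcal{O}$ there exists an $\mathfrak{sl}_2$-triple $\langle e,h,f\rangle$ with $h\in i\mathfrak k$. The height $\mathrm{ht}(\mathcal{O})$ of $\mathcal{O}=\mathrm{Ad}(G)e$ is the largest integer $k$ with $\mathrm{ad}(e)^k\neq0$. *)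

(* Defs.v *)
From mathcomp Require Import all_boot all_order all_algebra.
From mathcomp Require Import all_classical all_reals all_analysis.
From mathcomp Require Import complex.

Set Implicit Arguments.
Unset Strict Implicit.
Unset Printing Implicit Defensive.

Import Order.TTheory GRing.Theory Num.Theory.
Local Open Scope ring_scope.
Local Open Scope classical_set_scope.
Local Open Scope complex_scope.

Definition lie_algebra (K : fieldType) (d : nat)
    (br : 'rV[K]_d -> 'rV[K]_d -> 'rV[K]_d) : Prop :=
  [/\ (forall (a : K) x y z, br (a *: x + y) z = a *: br x z + br y z),
      (forall (a : K) x y z, br x (a *: y + z) = a *: br x y + br x z),
      (forall x, br x x = 0) &
      (forall x y z, br x (br y z) + br y (br z x) + br z (br x y) = 0)].

(* ad x, as a matrix acting on row vectors: u *m ad br x = br x u. *)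
Definition ad (K : fieldType) (d : nat) (br : 'rV[K]_d -> 'rV[K]_d -> 'rV[K]_d)
    (x : 'rV[K]_d) : 'M[K]_d := lin1_mx (br x).

(* An ideal, given as (the row space of) a square matrix I. *)
Definition lie_ideal (K : fieldType) (d : nat)
    (br : 'rV[K]_d -> 'rV[K]_d -> 'rV[K]_d) (I : 'M[K]_d) : Prop :=
  forall x y : 'rV[K]_d, (y <= I)%MS -> (br x y <= I)%MS.

Definition simple_lie (K : fieldType) (d : nat)
    (br : 'rV[K]_d -> 'rV[K]_d -> 'rV[K]_d) : Prop :=
  (exists x y, br x y != 0) /\
  (forall I : 'M[K]_d, lie_ideal br I -> I = 0 \/ (I == 1%:M)%MS).

Definition killing (K : fieldType) (d : nat)
    (br : 'rV[K]_d -> 'rV[K]_d -> 'rV[K]_d) (x y : 'rV[K]_d) : K :=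
  \tr (ad br x *m ad br y).

Section Complex.
Variable R : realType.
Local Notation C := R[i].

Definition compact_real_form (d : nat) (br : 'rV[C]_d -> 'rV[C]_d -> 'rV[C]_d)
    (k : 'rV[C]_d -> Prop) : Prop :=
  [/\ k 0,
      (forall x y, k x -> k y -> k (x + y)),
      (forall (a : C) x, a \is Num.real -> k x -> k (a *: x)) &
      (forall x y, k x -> k y -> k (br x y))] /\
  [/\ (forall z, exists x y, [/\ k x, k y & z = x + 'i *: y]),
      (forall x, k x -> k ('i *: x) -> x = 0) &
      (forall x, k x -> x != 0 -> killing br x x < 0)].

Definition in_ik (d : nat) (k : 'rV[C]_d -> Prop) (h : 'rV[C]_d) : Prop :=
  exists x, k x /\ h = 'i *: x.

Definition expmx (d : nat) (A : 'M[C]_d) : 'M[C]_d :=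
  limn (fun n : nat => \sum_(j < n) (j`!%:R)^-1 *: A ^+ j).

(* Adjoint orbit Ad(G) e, G the connected simply-connected group with Lie
   algebra g: Ad(G) is the group generated by the exp(ad x), x in g
   (closed under inverses since exp(ad x)^-1 = exp(ad (-x))). *)
Inductive adj_orbit (d : nat) (br : 'rV[C]_d -> 'rV[C]_d -> 'rV[C]_d)
    (e : 'rV[C]_d) : 'rV[C]_d -> Prop :=
  | adj_orbit_refl : adj_orbit br e e
  | adj_orbit_step y x : adj_orbit br e y -> adj_orbit br e (y *m expmx (ad br x)).

End Complex.

Definition sl2_triple (K : fieldType) (d : nat)
    (br : 'rV[K]_d -> 'rV[K]_d -> 'rV[K]_d) (e h f : 'rV[K]_d) : Prop :=
  [/\ br e f = h, br h e = 2%:R *: e & br h f = - (2%:R *: f)].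

Definition ad_nilpotent (K : fieldType) (d : nat)
    (br : 'rV[K]_d -> 'rV[K]_d -> 'rV[K]_d) (e : 'rV[K]_d) : Prop :=
  exists n : nat, ad br e ^+ n = 0.

(* ht(Ad(G)e) = n : n is the largest integer with ad(e)^n <> 0
   (independent of the representative e of the orbit). *)
Definition orbit_height (K : fieldType) (d : nat)
    (br : 'rV[K]_d -> 'rV[K]_d -> 'rV[K]_d) (e : 'rV[K]_d) (n : nat) : Prop :=
  ad br e ^+ n != 0 /\ (forall m : nat, (n < m)%N -> ad br e ^+ m = 0).

Definition moore_penrose (R : realType) (d : nat)
    (br : 'rV[R[i]]_d -> 'rV[R[i]]_d -> 'rV[R[i]]_d)
    (k : 'rV[R[i]]_d -> Prop) (O : 'rV[R[i]]_d -> Prop) : Prop :=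
  forall e, O e -> exists h f, sl2_triple br e h f /\ in_ik k h.

(* Main.v *)
(* Write [theta] for the conjugation of g fixing k, so that ik = {h | theta h = - h}, and
   [kil] for the Killing form; - kil x (theta y) is a positive definite Hermitian form.

   Let (e, h, f) be a triple with h in ik and ad(e)^N <> 0 = ad(e)^(N+1), N >= 3.  A vector
   v = ad(e)^N w <> 0 has weight N; x = [f, v] has weight N - 2 <> 0, lies in [e, g] and
   does not commute with e.  The neutral elements of the triples through g e, where
   g = exp (ad x), differ by elements of [g e, g] commuting with g e.  As [kil] is invariant,
   these are orthogonal to all neutral elements and to x, which forces a neutral element
   of g e in ik to be h; but g h = h - (N - 2) x is a neutral element as well, whence
   [x, e] = 0, a contradiction.  So the height of a Moore-Penrose orbit is at most 2, and it is
   at least 2 since ad(e)^2 f = - 2 e.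

   Conversely let ad(e)^3 = 0.  If [e, [e, z]] = 0 then ad(e) ad(z) is nilpotent, so e is
   orthogonal to the kernel of ad(e)^2 and thus lies in the image of ad(e)^2: this gives an
   sl2-triple (e, h0, f0).  Let F_j be the sum of the eigenspaces of ad(h0) of eigenvalue at
   least j, for -2 <= j <= 2.  Subtracting from h0 its Hermitian projection to F_1 gives an element
   h of ik.  It is still a neutral element of e because F_3 = 0 puts F_1
   inside ker ad(e) and im ad(e).

   Uniqueness of h holds at any height by the orthogonality above. *)
Require Import Defs.
From mathcomp Require Import all_boot all_order all_algebra.
From mathcomp Require Import all_classical all_reals all_analysis.
From mathcomp Require Import complex ring zify.
Set Implicit Arguments.
Unset Strict Implicit.
Unset Printing Implicit Defensive.
Import Order.TTheory GRing.Theory Num.Theory.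
Import numFieldNormedType.Exports.
Local Open Scope ring_scope.
Local Open Scope classical_set_scope.

(** * The matrix exponential *)

Section ComplexSeq.
Local Open Scope complex_scope.
Variable R : realType.
Local Notation C := R[i].
Local Notation Re := (@complex.Re R).
Local Notation Im := (@complex.Im R).
Local Notation normc := (@Normc.normc R).

(** Real and imaginary parts are kept apart so that the limit theorems for real sequences apply. *)
Definition cplx_lim (u : nat -> C) (l : C) :=
  ((fun n => Re (u n)) @ \oo --> Re l) /\ ((fun n => Im (u n)) @ \oo --> Im l).

Lemma ReD (x y : C) : Re (x + y) = Re x + Re y. Proof. by move: x y => [? ?] [? ?]. Qed.
Lemma ImD (x y : C) : Im (x + y) = Im x + Im y. Proof. by move: x y => [? ?] [? ?]. Qed.
Lemma ReM (x y : C) : Re (x * y) = Re x * Re y - Im x * Im y.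
Proof. by move: x y => [? ?] [? ?]. Qed.
Lemma ImM (x y : C) : Im (x * y) = Re x * Im y + Im x * Re y.
Proof. by move: x y => [? ?] [? ?]. Qed.

Lemma cplx_lim_uniq u l l' : cplx_lim u l -> cplx_lim u l' -> l = l'.
Proof.
case: l l' => a b [a' b'] [/= h1 h2] [/= h3 h4].
by rewrite (cvg_unique _ h1 h3) // (cvg_unique _ h2 h4).
Qed.

Lemma cplx_lim_cst l : cplx_lim (fun=> l) l.
Proof. by split; apply: cvg_cst. Qed.

Lemma cplx_limD u v l l' : cplx_lim u l -> cplx_lim v l' ->
  cplx_lim (fun n => u n + v n) (l + l').
Proof.
move=> [h1 h2] [h3 h4]; split.
  by rewrite ReD; under eq_fun do rewrite ReD; exact: cvgD.
by rewrite ImD; under eq_fun do rewrite ImD; exact: cvgD.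
Qed.

Lemma cplx_limM u v l l' : cplx_lim u l -> cplx_lim v l' ->
  cplx_lim (fun n => u n * v n) (l * l').
Proof.
move=> [h1 h2] [h3 h4]; split.
  by rewrite ReM; under eq_fun do rewrite ReM; apply: cvgB; exact: cvgM.
by rewrite ImM; under eq_fun do rewrite ImM; apply: cvgD; exact: cvgM.
Qed.

Lemma cplx_lim_sum (I : finType) (u : I -> nat -> C) (l : I -> C) :
  (forall i, cplx_lim (u i) (l i)) ->
  cplx_lim (fun n => \sum_i u i n) (\sum_i l i).
Proof.
move=> h; elim: (index_enum I) => [|i s IH].
  by rewrite big_nil; under eq_fun do rewrite big_nil; exact: cplx_lim_cst.
by rewrite big_cons; under eq_fun do rewrite big_cons; exact: cplx_limD.
Qed.

Lemma normc_ge0 (x : C) : 0 <= normc x.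
Proof. by case: x => a b; exact: sqrtr_ge0. Qed.

Lemma normc_normr (x : C) : `|x| = (normc x)%:C.
Proof. by []. Qed.

Lemma Re_le_normc (x : C) : `|Re x| <= normc x.
Proof. by case: x => a b /=; rewrite -sqrtr_sqr ler_wsqrtr // lerDl sqr_ge0. Qed.

Lemma Im_le_normc (x : C) : `|Im x| <= normc x.
Proof. by case: x => a b /=; rewrite -sqrtr_sqr ler_wsqrtr // lerDr sqr_ge0. Qed.

Lemma normc_sum I (r : seq I) (P : pred I) (F : I -> C) :
  normc (\sum_(i <- r | P i) F i) <= \sum_(i <- r | P i) normc (F i).
Proof.
elim/big_ind2: _ => //; first by rewrite Normc.normc0.
by move=> x a y b h1 h2; apply: le_trans (le_normcD _ _) _; exact: lerD.
Qed.

Lemma normc_nat n : normc n%:R = n%:R.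
Proof. by apply: complexI; rewrite -normc_normr normr_nat rmorph_nat. Qed.

Lemma cplx_lim_norm0 (u : nat -> C) (r : nat -> R) :
  (forall n, normc (u n) <= r n) -> r @ \oo --> 0 -> cplx_lim u 0.
Proof.
move=> h hr; split => /=; apply: (@squeeze_cvgr _ _ _ _ (fun n => - r n) r) => //.
- apply: nearW => n; rewrite -ler_norml; exact: le_trans (Re_le_normc _) (h n).
- by rewrite -oppr0; exact: cvgN.
- apply: nearW => n; rewrite -ler_norml; exact: le_trans (Im_le_normc _) (h n).
- by rewrite -oppr0; exact: cvgN.
Qed.

End ComplexSeq.

Section Expmx.
Local Open Scope complex_scope.
Variable R : realType.
Local Notation C := R[i].
Local Notation Re := (@complex.Re R).
Local Notation Im := (@complex.Im R).
Local Notation normc := (@Normc.normc R).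

Definition expmx_part d (A : 'M[C]_d) (N : nat) : 'M[C]_d :=
  \sum_(j < N) (j`!%:R)^-1 *: A ^+ j.

Definition mx_bound m n (A : 'M[C]_(m, n)) : R := \sum_i \sum_j normc (A i j).

Lemma mx_bound_ge0 m n (A : 'M[C]_(m, n)) : 0 <= mx_bound A.
Proof. by apply: sumr_ge0 => i _; apply: sumr_ge0 => j _; exact: normc_ge0. Qed.

Lemma normc_mulmx m n (u : 'M[C]_(m, n)) p (A : 'M[C]_(n, p)) M i j :
  0 <= M -> (forall i j, normc (A i j) <= M) -> normc ((u *m A) i j) <= mx_bound u * M.
Proof.
move=> M0 h; rewrite mxE; apply: le_trans (normc_sum _ _ _) _.
rewrite /mx_bound mulr_suml (bigD1 i) //= mulr_suml -[leLHS]addr0.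
apply: lerD.
  apply: ler_sum => k _; rewrite Normc.normcM.
  by apply: ler_wpM2l; [exact: normc_ge0|exact: h].
apply: sumr_ge0 => k _; apply: mulr_ge0 => //.
by apply: sumr_ge0 => l _; exact: normc_ge0.
Qed.

Lemma normc_expmx d (A : 'M[C]_d) n i j :
  normc ((A ^+ n) i j) <= mx_bound A ^+ n.
Proof.
elim: n i j => [|n IH] i j; last first.
  by rewrite exprS exprS; by apply: normc_mulmx => //; rewrite exprn_ge0 // mx_bound_ge0.
rewrite !expr0 mxE; case: (i == j); rewrite ?mulr1n ?mulr0n.
  by rewrite Normc.normc1.
by rewrite Normc.normc0.
Qed.

Lemma expmx_part_entry d (A : 'M[C]_d) N i j :
  expmx_part A N i j = \sum_(n < N) (n`!%:R)^-1 * (A ^+ n) i j.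
Proof. by rewrite /expmx_part summxE; apply: eq_bigr => n _; rewrite mxE. Qed.

(** Each coordinate is a real series dominated termwise by the exponential series of [mx_bound A];
    [key] treats real and imaginary parts alike. *)
Lemma expmx_part_cvg d (A : 'M[C]_d) i j :
  exists l, cplx_lim (fun N => expmx_part A N i j) l.
Proof.
pose a n : C := (n`!%:R)^-1 * (A ^+ n) i j.
have key (f : C -> R) : f 0 = 0 -> (forall x y, f (x + y) = f x + f y) ->
    (forall x, `|f x| <= normc x) ->
    cvgn (fun N => f (expmx_part A N i j)).
  move=> f0 fD fb.
  have -> : (fun N => f (expmx_part A N i j)) = series (fun n => f (a n)).
    apply/funext => N; rewrite expmx_part_entry /series /= big_mkord.
    by rewrite (big_morph f fD f0).
  apply: normed_cvg.
  apply: (@series_le_cvg _ _ (exp_coeff (mx_bound A))) => [n|n|n|].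
  - exact: normr_ge0.
  - by apply: exp_coeff_ge0; exact: mx_bound_ge0.
  - apply: le_trans (fb _) _; rewrite /a /exp_coeff /= Normc.normcM.
    rewrite mulrC Normc.normcV normc_nat.
    by apply: ler_wpM2r; [rewrite invr_ge0 ler0n|exact: normc_expmx].
  - exact: is_cvg_series_exp_coeff.
have hR := key Re erefl (@ReD R) (@Re_le_normc R).
have hI := key Im erefl (@ImD R) (@Im_le_normc R).
by exists (Complex (limn (fun N => Re (expmx_part A N i j)))
                   (limn (fun N => Im (expmx_part A N i j)))).
Qed.

(** [expmx] is a [limn], informative only once the partial sums converge as matrices. The entrywise
    limits are therefore gathered in a matrix [L], and convergence to [L] is proved in the matrix
    topology. *)
Lemma expmx_entry d (A : 'M[C]_d) i j :
  cplx_lim (fun N => expmx_part A N i j) (expmx A i j).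
Proof.
pose K := (C : numFieldType).
have [L hL] : {L : 'M[K]_d | forall i j, cplx_lim (fun N => expmx_part A N i j) (L i j)}.
  exists (\matrix_(i, j) sval (cid (expmx_part_cvg A i j))) => k l.
  by rewrite mxE; case: cid.
have cvL : (expmx_part A : nat -> 'M[K]_d) @ \oo --> L.
  apply/cvg_ballP => e e0.
  (* A positive element of [R[i]] is real. *)
  have [r r0 er] : exists2 r : R, 0 < r & e = r%:C.
    move: e0; case: (e) => a b; rewrite ltcE /= => /andP[/eqP -> a0].
    by exists a.
  have h k l : \forall N \near \oo, `|L k l - expmx_part A N k l| < e.
    have [/cvgrPdist_lt hR /cvgrPdist_lt hI] := hL k l.
    have r2 : 0 < r / 2 by rewrite divr_gt0.
    near=> N.
    have h1 : `|Re (L k l) - Re (expmx_part A N k l)| < r / 2.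
      by near: N; exact: hR.
    have h2 : `|Im (L k l) - Im (expmx_part A N k l)| < r / 2.
      by near: N; exact: hI.
    set z := L k l - _.
    have hz : z = (Re z)%:C + 'i%C * (Im z)%:C by exact: complexE.
    rewrite er hz; apply: le_lt_trans (ler_normD _ _) _.
    rewrite normrM normc_normr.
    have -> : `|'i%C : C| = 1.
      by rewrite normc_normr /= expr0n expr1n /= add0r sqrtr1.
    rewrite mul1r normc_normr -rmorphD ltcR /=.
    rewrite expr0n !addr0 /= !sqrtr_sqr.
    have -> : Re z = Re (L k l) - Re (expmx_part A N k l).
      by rewrite /z; case: (L k l) => ? ?; case: (expmx_part A N k l).
    have -> : Im z = Im (L k l) - Im (expmx_part A N k l).
      by rewrite /z; case: (L k l) => ? ?; case: (expmx_part A N k l).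
    by rewrite [ltRHS]splitr ltrD.
  have h' : \forall N \near \oo, forall k l, `|L k l - expmx_part A N k l| < e.
    pose F := fun (kl : 'I_d * 'I_d) N => `|L kl.1 kl.2 - expmx_part A N kl.1 kl.2| < e.
    have : \forall N \near \oo, forall kl, F kl N.
      by apply: filter_forall => kl; exact: h.
    by apply: filterS => N hN k l; exact: (hN (k, l)).
  by apply: filterS h' => N hN; split.
(* As a limit exists, the value selected by [limn] is one. *)
have cvE : (expmx_part A : nat -> 'M[K]_d) @ \oo --> (expmx A : 'M[K]_d).
  by apply/cvg_ex; exists L.
have hE r : 0 < r -> \forall N \near \oo, normc (expmx A i j - expmx_part A N i j) < r.
  move=> r0; have r0' : 0 < (r%:C : K) by rewrite ltcR.
  have /cvg_ballP/(_ _ r0') := cvE.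
  apply: filterS => N [_ /(_ i j)].
  by rewrite /ball /= -ltcR.
split; apply/cvgrPdist_lt => r /hE; apply: filterS => N; apply: le_lt_trans;
  move: (expmx A i j) (expmx_part A N i j) => [a b] [a' b'].
  exact: (Re_le_normc (Complex (a - a') (b - b'))).
exact: (Im_le_normc (Complex (a - a') (b - b'))).
Unshelve. all: by end_near.
Qed.

End Expmx.

Lemma mxpowSr (K : pzRingType) n (M : 'M[K]_n) k : M ^+ k.+1 = M ^+ k *m M.
Proof. exact: exprSr. Qed.

(** * Bilinear maps in coordinates *)

Section Bilinear.
Variable C : fieldType.
Variables (d p : nat) (beta : 'rV[C]_d -> 'rV[C]_d -> 'rV[C]_p).
Hypothesis betal : forall a x y z, beta (a *: x + y) z = a *: beta x z + beta y z.
Hypothesis betar : forall a x y z, beta x (a *: y + z) = a *: beta x y + beta x z.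

Lemma bil0l z : beta 0 z = 0.
Proof. by have := betal (-1) 0 0 z; rewrite scaler0 addr0 scaleN1r addNr. Qed.

Lemma bil0r x : beta x 0 = 0.
Proof. by have := betar (-1) x 0 0; rewrite scaler0 addr0 scaleN1r addNr. Qed.

Lemma bilZl a x z : beta (a *: x) z = a *: beta x z.
Proof. by rewrite -[a *: x]addr0 betal bil0l addr0. Qed.

Lemma bilZr a x z : beta x (a *: z) = a *: beta x z.
Proof. by rewrite -[a *: z]addr0 betar bil0r addr0. Qed.

Lemma bilDl x y z : beta (x + y) z = beta x z + beta y z.
Proof. by rewrite -[x]scale1r betal !scale1r. Qed.

Lemma bilDr x y z : beta x (y + z) = beta x y + beta x z.
Proof. by rewrite -[y]scale1r betar !scale1r. Qed.

Lemma bil_suml I (r : seq I) (P : pred I) (F : I -> 'rV[C]_d) z :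
  beta (\sum_(i <- r | P i) F i) z = \sum_(i <- r | P i) beta (F i) z.
Proof. by apply: (big_morph (beta^~ z)) => [x y|]; rewrite ?bilDl ?bil0l. Qed.

Lemma bil_sumr I (r : seq I) (P : pred I) (F : I -> 'rV[C]_d) x :
  beta x (\sum_(i <- r | P i) F i) = \sum_(i <- r | P i) beta x (F i).
Proof. by apply: (big_morph (beta x)) => [y z|]; rewrite ?bilDr ?bil0r. Qed.

Lemma bil_coord x y k : beta x y 0 k =
  \sum_i \sum_j x 0 i * y 0 j * beta (delta_mx 0 i) (delta_mx 0 j) 0 k.
Proof.
rewrite {1}(row_sum_delta x) bil_suml summxE; apply: eq_bigr => i _.
rewrite bilZl {1}(row_sum_delta y) bil_sumr scaler_sumr summxE.
by apply: eq_bigr => j _; rewrite bilZr scalerA mxE.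
Qed.

End Bilinear.

(** * Bilinear maps under exponentials, by Cauchy products *)

Section CauchyProduct.
Local Open Scope complex_scope.

(** The square is cut along its antidiagonal: the indices with [i + j < N] are regrouped by their
    sum, the others form the tail. *)
Lemma square_sum_split (V : nmodType) (g : nat -> nat -> V) N :
  \sum_(0 <= i < N) \sum_(0 <= j < N) g i j =
  \sum_(0 <= n < N) \sum_(0 <= i < n.+1) g i (n - i)%N +
  \sum_(0 <= i < N) \sum_(N - i <= j < N) g i j.
Proof.
have tri M : \sum_(0 <= i < M) \sum_(0 <= j < M - i) g i j =
    \sum_(0 <= n < M) \sum_(0 <= i < n.+1) g i (n - i)%N.
  elim: M => [|M IH]; first by rewrite !big_geq.
  rewrite [RHS]big_nat_recr //= -IH.
  have -> : \sum_(0 <= i < M) \sum_(0 <= j < M - i) g i j =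
            \sum_(0 <= i < M.+1) \sum_(0 <= j < M - i) g i j.
    by rewrite big_nat_recr //= subnn (big_geq (leqnn 0)) addr0.
  rewrite -big_split /=; apply: eq_big_nat => i /andP[_ iM].
  by rewrite subSn // big_nat_recr.
rewrite -tri -big_split /=; apply: eq_big_nat => i _.
by rewrite -big_cat_nat //= leq_subr.
Qed.

Variable R : realType.
Local Notation C := R[i].
Local Notation normc := (@Normc.normc R).

(** By the binomial theorem the tail is the square of the partial sum for [M] minus the partial sum
    for [M + M]; both tend to [expR (M + M)]. *)
Lemma exp_coeff_tail_cvg (M : R) :
  (fun N => \sum_(0 <= i < N) \sum_(N - i <= j < N) exp_coeff M i * exp_coeff M j)
    @ \oo --> 0.
Proof.
have -> : (fun N => \sum_(0 <= i < N) \sum_(N - i <= j < N)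
                       exp_coeff M i * exp_coeff M j) =
    (fun N => series (exp_coeff M) N * series (exp_coeff M) N
              - series (exp_coeff (M + M)) N).
  apply/funext => N; apply/eqP; rewrite eq_sym subr_eq addrC; apply/eqP.
  have := square_sum_split (fun i j => exp_coeff M i * exp_coeff M j) N.
  rewrite /series /= mulr_suml => E.
  transitivity (\sum_(0 <= i < N) \sum_(0 <= j < N) exp_coeff M i * exp_coeff M j).
    by apply: eq_bigr => i _; rewrite mulr_sumr.
  rewrite E; congr (_ + _); apply: eq_bigr => n _.
  rewrite [RHS]/exp_coeff /= exprDn mulr_suml big_mkord.
  apply: eq_bigr => -[i /= ltin] _; rewrite /exp_coeff /= ltnS in ltin *.
  have fn0 k : (k`!%:R : R) != 0 by rewrite pnatr_eq0 -lt0n fact_gt0.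
  rewrite -(bin_fact ltin) -mulr_natr !natrM.
  have b0 : ('C(n, i)%:R : R) != 0 by rewrite pnatr_eq0 -lt0n bin_gt0.
  field.
  by rewrite !fn0 b0.
rewrite -(subrr (expR (M + M))) {1}expRD.
apply: cvgB; last exact: is_cvg_series_exp_coeff.
by apply: cvgM; exact: is_cvg_series_exp_coeff.
Qed.

Variables (d p : nat) (beta : 'rV[C]_d -> 'rV[C]_d -> 'rV[C]_p).
Hypothesis betal : forall a x y z, beta (a *: x + y) z = a *: beta x z + beta y z.
Hypothesis betar : forall a x y z, beta x (a *: y + z) = a *: beta x y + beta x z.

Variables (A : 'M[C]_d) (B : 'M[C]_p).
Hypothesis betaA : forall x y, beta (x *m A) y + beta x (y *m A) = beta x y *m B.

Let term x y i j := ((i`!%:R)^-1 * (j`!%:R)^-1) *: beta (x *m A ^+ i) (y *m A ^+ j).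

(** The iterated Leibniz rule. The factor [n.+1 = i + (n.+1 - i)] splits each term in two; lowering
    one index in each and applying [betaA] produces one factor [B]. *)
Lemma bil_term_diag x y n :
  \sum_(0 <= i < n.+1) term x y i (n - i)%N = (n`!%:R)^-1 *: (beta x y *m B ^+ n).
Proof.
have fn0 k : (k`!%:R : C) != 0 by rewrite pnatr_eq0 -lt0n fact_gt0.
elim: n => [|n IH].
  rewrite big_nat1 /term /= !expr0 !mulmx1 fact0 invr1 mulr1 ?scale1r //.
suff E : n.+1%:R *: \sum_(0 <= i < n.+2) term x y i (n.+1 - i)%N =
    (\sum_(0 <= i < n.+1) term x y i (n - i)%N) *m B.
  have n0 : (n.+1%:R : C) != 0 by rewrite pnatr_eq0.
  apply: (scalerI n0); rewrite E IH -scalemxAl -mulmxA -mxpowSr scalerA.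
  by rewrite factS natrM invfM mulrA divff // mul1r.
have tS u v i j : i.+1%:R *: term u v i.+1 j =
    ((i`!%:R)^-1 * (j`!%:R)^-1) *: beta (u *m A ^+ i *m A) (v *m A ^+ j).
  rewrite /term scalerA factS natrM invfM !mulrA divff ?pnatr_eq0 // mul1r.
  by rewrite mxpowSr mulmxA.
have tS' u v i j : j.+1%:R *: term u v i j.+1 =
    ((i`!%:R)^-1 * (j`!%:R)^-1) *: beta (u *m A ^+ i) (v *m A ^+ j *m A).
  rewrite /term scalerA factS natrM invfM mulrCA !mulrA [_ / _.+1%:R]mulrC.
  rewrite mulrCA -!mulrA [_ * (_.+1%:R * _)]mulrA [_^-1 * _.+1%:R]mulrC.
  rewrite divff ?pnatr_eq0 // mul1r.
  by rewrite mxpowSr mulmxA.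
transitivity (\sum_(0 <= i < n.+2) (i%:R *: term x y i (n.+1 - i)%N) +
              \sum_(0 <= i < n.+2) ((n.+1 - i)%:R *: term x y i (n.+1 - i)%N)).
  rewrite scaler_sumr -big_split /=; apply: eq_big_nat => i /andP[_ iN].
  by rewrite -scalerDl -natrD subnKC.
rewrite big_nat_recl // scale0r add0r.
rewrite [X in _ + X]big_nat_recr //= subnn scale0r addr0.
rewrite -big_split mulmx_suml; apply: eq_big_nat => i /andP[_ iN].
rewrite subSS tS subSn // tS' /= -scalerDr betaA.
by rewrite /term scalemxAl.
Qed.

(** Applied to the bracket with [B = ad br x], this makes [exp (ad x)] an automorphism; applied to
    the Killing form with [B = 0], an isometry. At finite order the two sides differ by the tail of
    [square_sum_split], bounded by a multiple of the real exponential tail. *)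
Lemma bil_expmx x y : beta (x *m expmx A) (y *m expmx A) = beta x y *m expmx B.
Proof.
have lim_mul m (M : 'M[C]_m) (z : 'rV[C]_m) k :
    cplx_lim (fun N => (z *m expmx_part M N) 0 k) ((z *m expmx M) 0 k).
  rewrite mxE; under eq_fun do rewrite mxE.
  apply: cplx_lim_sum => i; apply: cplx_limM; first exact: cplx_lim_cst.
  exact: expmx_entry.
apply/rowP => k.
have h1 : cplx_lim (fun N => beta (x *m expmx_part A N) (y *m expmx_part A N) 0 k)
                   (beta (x *m expmx A) (y *m expmx A) 0 k).
  rewrite (bil_coord betal betar); under eq_fun do rewrite (bil_coord betal betar).
  apply: cplx_lim_sum => i; apply: cplx_lim_sum => j.
  apply: cplx_limM; last exact: cplx_lim_cst.
  by apply: cplx_limM; exact: lim_mul.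
apply: (cplx_lim_uniq h1).
have powE (z : 'rV[C]_d) N : z *m expmx_part A N =
    \sum_(0 <= i < N) (i`!%:R)^-1 *: (z *m A ^+ i).
  rewrite /expmx_part mulmx_sumr big_mkord; apply: eq_bigr => i _.
  by rewrite scalemxAr.
have E N : beta (x *m expmx_part A N) (y *m expmx_part A N) =
   beta x y *m expmx_part B N + \sum_(0 <= i < N) \sum_(N - i <= j < N) term x y i j.
  transitivity (\sum_(0 <= i < N) \sum_(0 <= j < N) term x y i j).
    rewrite !powE (bil_suml betal); apply: eq_bigr => i _.
    rewrite (bil_sumr betar); apply: eq_bigr => j _.
    by rewrite (bilZl betal) (bilZr betar) scalerA.
  rewrite square_sum_split; congr (_ + _).
  rewrite /expmx_part mulmx_sumr big_mkord; apply: eq_bigr => n _.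
  by rewrite bil_term_diag scalemxAr.
under eq_fun do rewrite E mxE.
rewrite -[X in cplx_lim _ X]addr0; apply: cplx_limD; first exact: lim_mul.
pose M := mx_bound A.
pose K := \sum_i \sum_j mx_bound x * mx_bound y *
             normc (beta (delta_mx 0 i) (delta_mx 0 j) 0 k).
apply: (@cplx_lim_norm0 _ _ (fun N => K * \sum_(0 <= i < N) \sum_(N - i <= j < N)
          exp_coeff M i * exp_coeff M j)); last first.
  have h2 : (fun=> K) @ \oo --> K by exact: cvg_cst.
  by have := cvgM h2 (exp_coeff_tail_cvg M); rewrite mulr0; apply.
move=> N; rewrite summxE; apply: le_trans (normc_sum _ _ _) _.
rewrite mulr_sumr; apply: ler_sum => i _.
rewrite summxE; apply: le_trans (normc_sum _ _ _) _.
rewrite mulr_sumr; apply: ler_sum => j _.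
rewrite /term mxE !Normc.normcM !Normc.normcV !normc_nat /exp_coeff /=.
have -> : K * (M ^+ i / i`!%:R * (M ^+ j / j`!%:R)) =
  (i`!%:R^-1 / j`!%:R) * (K * (M ^+ i * M ^+ j)) by ring.
apply: ler_wpM2l.
  by rewrite mulr_ge0 // invr_ge0 ler0n.
have M0 : 0 <= M by exact: mx_bound_ge0.
have zb (z : 'rV[C]_d) n q : normc ((z *m A ^+ n) 0 q) <= mx_bound z * M ^+ n.
  by apply: normc_mulmx; [exact: exprn_ge0|move=> *; exact: normc_expmx].
rewrite (bil_coord betal betar) mulr_suml; apply: le_trans (normc_sum _ _ _) _.
apply: ler_sum => s _; rewrite mulr_suml; apply: le_trans (normc_sum _ _ _) _.
apply: ler_sum => t _; rewrite !Normc.normcM [leRHS]mulrAC.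
apply: ler_wpM2r; first exact: normc_ge0.
by rewrite [leRHS]mulrACA; apply: ler_pM => //; exact: normc_ge0.
Qed.

End CauchyProduct.

Section ExpmxValues.
Variable R : realType.
Local Notation C := R[i].

(** The partial sums are stationary from order 2 on. *)
Lemma expmx_deg1 d (A : 'M[C]_d) (y : 'rV[C]_d) :
  y *m A *m A = 0 -> y *m expmx A = y + y *m A.
Proof.
move=> yAA; apply/rowP => k.
have h1 : cplx_lim (fun N => (y *m expmx_part A N) 0 k) ((y *m expmx A) 0 k).
  rewrite mxE; under eq_fun do rewrite mxE.
  apply: cplx_lim_sum => i; apply: cplx_limM; first exact: cplx_lim_cst.
  exact: expmx_entry.
apply: (cplx_lim_uniq h1).
have yA n : y *m A ^+ n.+2 = 0.
  by rewrite exprS -[_ * _]/(A *m _) exprS -[_ * _]/(A *m _) !mulmxA yAA mul0mx.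
have E N : y *m expmx_part A N.+2 = y + y *m A.
  rewrite /expmx_part !big_ord_recl !mulmxDr mulmx_sumr big1 => [|i _]; last first.
    by rewrite -scalemxAr /= /bump /= !add1n yA scaler0.
  rewrite -!scalemxAr /= /bump /= addn0 expr0 expr1 mulmx1 addr0.
  by rewrite (_ : 1`! = 1)%N // fact0 invr1 !scale1r.
suff E' : \forall N \near \oo, (y *m expmx_part A N) 0 k = (y + y *m A) 0 k.
  by split; apply: cvg_near_cst; apply: filterS E' => N ->.
by exists 2%N => // -[|[|N]] // _; rewrite E.
Qed.

Lemma expmx_fix d (A : 'M[C]_d) (y : 'rV[C]_d) : y *m A = 0 -> y *m expmx A = y.
Proof. by move=> yA; rewrite expmx_deg1 yA ?mul0mx ?addr0. Qed.

Lemma expmx0 d : expmx (0 : 'M[C]_d) = 1%:M.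
Proof.
apply/row_matrixP => i; rewrite rowE [RHS]rowE mulmx1.
by apply: expmx_fix; rewrite mulmx0.
Qed.

End ExpmxValues.

(** * Lie algebras and the Killing form *)

Section LieAlgebra.
Variables (C : fieldType) (d : nat) (br : 'rV[C]_d -> 'rV[C]_d -> 'rV[C]_d).
Hypothesis Hlie : lie_algebra br.
Implicit Types x y z : 'rV[C]_d.

Lemma br_bilinl a x y z : br (a *: x + y) z = a *: br x z + br y z.
Proof. by case: Hlie. Qed.
Lemma br_bilinr a x y z : br x (a *: y + z) = a *: br x y + br x z.
Proof. by case: Hlie. Qed.

Definition br0l := bil0l br_bilinl.
Definition br0r := bil0r br_bilinr.
Definition brZl := bilZl br_bilinl.
Definition brZr := bilZr br_bilinr.
Definition brDl := bilDl br_bilinl.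
Definition brDr := bilDr br_bilinr.

Lemma brNl x z : br (- x) z = - br x z.
Proof. by rewrite -scaleN1r brZl scaleN1r. Qed.
Lemma brNr x z : br x (- z) = - br x z.
Proof. by rewrite -scaleN1r brZr scaleN1r. Qed.
Lemma brBl x y z : br (x - y) z = br x z - br y z.
Proof. by rewrite brDl brNl. Qed.
Lemma brBr x y z : br x (y - z) = br x y - br x z.
Proof. by rewrite brDr brNr. Qed.

Lemma brxx x : br x x = 0. Proof. by case: Hlie. Qed.

Lemma brC x y : br x y = - br y x.
Proof.
have := brxx (x + y); rewrite brDl !brDr !brxx add0r addr0.
by move/eqP; rewrite addr_eq0 => /eqP.
Qed.

Lemma br_jacobi x y z : br x (br y z) = br (br x y) z + br y (br x z).
Proof.
case: Hlie => _ _ _ /(_ x y z); rewrite [br z (br _ _)]brC [br z x]brC brNr.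
by move/eqP; rewrite subr_eq0 => /eqP <-; rewrite addrNK.
Qed.

Lemma mul_ad x y : y *m ad br x = br x y.
Proof.
apply/rowP => k; rewrite /ad mxE [y in RHS]row_sum_delta.
rewrite (bil_sumr br_bilinr) summxE; apply: eq_bigr => i _.
by rewrite brZr !mxE.
Qed.

Lemma mx_rowP m n (A B : 'M[C]_(m, n)) : (forall y : 'rV_m, y *m A = y *m B) -> A = B.
Proof. by move=> h; apply/row_matrixP => i; rewrite !rowE h. Qed.

Lemma ad_bilin a x y : ad br (a *: x + y) = a *: ad br x + ad br y.
Proof.
by apply: mx_rowP => z; rewrite mulmxDr -scalemxAr !mul_ad br_bilinl.
Qed.

(** The two products come in reverse order because matrices act on row vectors from the right. *)
Lemma ad_br x y : ad br (br x y) = ad br y *m ad br x - ad br x *m ad br y.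
Proof.
apply: mx_rowP => z; rewrite mulmxBr !mulmxA !mul_ad br_jacobi.
by rewrite addrK.
Qed.

Local Notation kil := (killing br).

Lemma kil_bilinl a x y z : kil (a *: x + y) z = a * kil x z + kil y z.
Proof. by rewrite /killing ad_bilin mulmxDl -scalemxAl mxtraceD mxtraceZ. Qed.
Lemma kilC x y : kil x y = kil y x.
Proof. by rewrite /killing mxtrace_mulC. Qed.
Lemma kil_bilinr a x y z : kil x (a *: y + z) = a * kil x y + kil x z.
Proof. by rewrite !(kilC x) kil_bilinl. Qed.
Lemma kilDl x y z : kil (x + y) z = kil x z + kil y z.
Proof. by rewrite -[x]scale1r kil_bilinl scale1r mul1r. Qed.
Lemma kilDr x y z : kil x (y + z) = kil x y + kil x z.
Proof. by rewrite !(kilC x) kilDl. Qed.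
Lemma kil0l x : kil 0 x = 0.
Proof. by have := kil_bilinl (-1) 0 0 x; rewrite scaler0 addr0 mulN1r addNr. Qed.
Lemma kil0r x : kil x 0 = 0.
Proof. by rewrite kilC kil0l. Qed.
Lemma kilZl a x z : kil (a *: x) z = a * kil x z.
Proof. by rewrite -[a *: x]addr0 kil_bilinl kil0l addr0. Qed.
Lemma kilZr a x z : kil x (a *: z) = a * kil x z.
Proof. by rewrite !(kilC x) kilZl. Qed.
Lemma kilNl x z : kil (- x) z = - kil x z.
Proof. by rewrite -scaleN1r kilZl mulN1r. Qed.
Lemma kilNr x z : kil x (- z) = - kil x z.
Proof. by rewrite !(kilC x) kilNl. Qed.
Lemma kilBl x y z : kil (x - y) z = kil x z - kil y z.
Proof. by rewrite kilDl kilNl. Qed.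
Lemma kilBr x y z : kil x (y - z) = kil x y - kil x z.
Proof. by rewrite kilDr kilNr. Qed.

Lemma kil_suml I (r : seq I) (P : pred I) (F : I -> 'rV[C]_d) z :
  kil (\sum_(i <- r | P i) F i) z = \sum_(i <- r | P i) kil (F i) z.
Proof. by apply: (big_morph (kil^~ z)) => [x y|]; rewrite ?kilDl ?kil0l. Qed.

Lemma kil_sumr I (r : seq I) (P : pred I) (F : I -> 'rV[C]_d) x :
  kil x (\sum_(i <- r | P i) F i) = \sum_(i <- r | P i) kil x (F i).
Proof. by rewrite kilC kil_suml; apply: eq_bigr => i _; rewrite kilC. Qed.

Lemma kil_inv x y z : kil (br x y) z = kil x (br y z).
Proof.
rewrite /killing !ad_br mulmxBl mulmxBr !linearB /=.
congr (_ - _); last by rewrite mulmxA.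
by rewrite -mulmxA mxtrace_mulC mulmxA.
Qed.

Lemma kil_inv2 x y z : kil (br x y) z = - kil y (br x z).
Proof. by rewrite brC kilNl kil_inv. Qed.

(** Invariance gives [(a + b) * kil x y = 0]. *)
Lemma kil_weight h x y (a b : C) :
  br h x = a *: x -> br h y = b *: y -> a + b != 0 -> kil x y = 0.
Proof.
move=> hx hy ab; apply: (mulfI ab); rewrite mulr0.
by rewrite mulrDl -kilZl -kilZr -hx -hy kil_inv2 addNr.
Qed.

Lemma br_weight h x y (a b : C) :
  br h x = a *: x -> br h y = b *: y -> br h (br x y) = (a + b) *: br x y.
Proof. by move=> hx hy; rewrite br_jacobi hx hy brZl brZr scalerDl. Qed.

(** Both [h] and [h'] lie in the image of [ad br e] and [h - h'] in its kernel; by invariance, image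
    and kernel are orthogonal. *)
Lemma kil_neutral e h f h' f' :
  sl2_triple br e h f -> sl2_triple br e h' f' ->
  kil h (h - h') = 0 /\ kil h' (h - h') = 0.
Proof.
move=> [ef he _] [ef' he' _].
have hh' : h - h' = br e (f - f') by rewrite brBr ef ef'.
have eh : br e (h - h') = 0 by rewrite brC brBl he he' subrr oppr0.
split; first by rewrite -{1}ef kil_inv2 eh kil0r oppr0.
by rewrite -{1}ef' kil_inv2 eh kil0r oppr0.
Qed.

End LieAlgebra.

(** Every root of the characteristic polynomial is an eigenvalue, hence zero, so the polynomial is a
    power of the variable and its trace coefficient vanishes. *)
Lemma trace_nilpotent (C : closedFieldType) d (A : 'M[C]_d) n : A ^+ n = 0 -> \tr A = 0.
Proof.
case: d A => [|d] A An; first by rewrite /mxtrace big_ord0.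
have [r Er] := closed_field_poly_normal (char_poly A).
rewrite (monicP (char_poly_monic A)) scale1r in Er.
have r0 : all (pred1 (0 : C)) r.
  apply/allP => x xr; have : root (char_poly A) x by rewrite Er root_prod_XsubC.
  rewrite -eigenvalue_root_char => /eigenvalueP[v vA v0] /=.
  have vAn m : v *m A ^+ m = x ^+ m *: v.
    elim: m => [|m IH]; first by rewrite !expr0 mulmx1 scale1r.
    by rewrite mxpowSr mulmxA IH -scalemxAl vA scalerA -exprSr.
  have := vAn n; rewrite An mulmx0 => /esym/eqP.
  by rewrite scaler_eq0 (negPf v0) orbF expf_eq0 => /andP[].
have E : char_poly A = 'X^(size r).
  rewrite Er; elim: (r) r0 => [|x s IH] /=; first by rewrite big_nil expr0.
  by case/andP => /eqP -> /IH hs; rewrite big_cons hs subr0 exprS.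
have := size_char_poly A; rewrite E size_polyXn => -[sr].
have := char_poly_trace A isT; rewrite E sr coefXn /= ltn_eqF //.
by move/esym/eqP; rewrite oppr_eq0 => /eqP.
Qed.

(** * Conjugations and inner automorphisms *)

(** Abstracts the conjugation fixing a compact form, so that the algebra below runs over any
    [numClosedFieldType]. *)
Definition cartan_conj (C : numClosedFieldType) d
    (br : 'rV[C]_d -> 'rV[C]_d -> 'rV[C]_d) (theta : 'rV[C]_d -> 'rV[C]_d) : Prop :=
  [/\ (forall a x y, theta (a *: x + y) = a^* *: theta x + theta y),
      involutive theta,
      (forall x y, theta (br x y) = br (theta x) (theta y)),
      (forall x y, killing br (theta x) (theta y) = (killing br x y)^*) &
      (forall x, x != 0 -> killing br x (theta x) < 0)].

Section CartanConj.
Variables (C : numClosedFieldType) (d : nat) (br : 'rV[C]_d -> 'rV[C]_d -> 'rV[C]_d).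
Hypothesis Hlie : lie_algebra br.
Variable theta : 'rV[C]_d -> 'rV[C]_d.
Hypothesis Htheta : cartan_conj br theta.
Local Notation kil := (killing br).
Implicit Types x y z : 'rV[C]_d.

Lemma thetaK : involutive theta. Proof. by case: Htheta. Qed.
Lemma theta_br x y : theta (br x y) = br (theta x) (theta y).
Proof. by case: Htheta. Qed.
Lemma kil_theta x y : kil (theta x) (theta y) = (kil x y)^*.
Proof. by case: Htheta. Qed.
Lemma theta_bilin a x y : theta (a *: x + y) = a^* *: theta x + theta y.
Proof. by case: Htheta. Qed.
Lemma thetaD x y : theta (x + y) = theta x + theta y.
Proof. by rewrite -[x]scale1r theta_bilin conjC1 !scale1r. Qed.
Lemma theta0 : theta 0 = 0.
Proof. by have := theta_bilin (-1) 0 0; rewrite rmorphN1 scaler0 addr0 scaleN1r addNr. Qed.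
Lemma thetaZ a x : theta (a *: x) = a^* *: theta x.
Proof. by rewrite -[a *: x]addr0 theta_bilin theta0 addr0. Qed.
Lemma thetaN x : theta (- x) = - theta x.
Proof. by rewrite -scaleN1r thetaZ rmorphN1 scaleN1r. Qed.
Lemma thetaB x y : theta (x - y) = theta x - theta y.
Proof. by rewrite thetaD thetaN. Qed.
Lemma theta_sum I (r : seq I) (P : pred I) (F : I -> 'rV[C]_d) :
  theta (\sum_(i <- r | P i) F i) = \sum_(i <- r | P i) theta (F i).
Proof. by apply: (big_morph theta) => [x y|]; rewrite ?thetaD ?theta0. Qed.

Lemma kil_thetar x y : kil x (theta y) = (kil (theta x) y)^*.
Proof. by rewrite -kil_theta thetaK. Qed.

Lemma kil_theta_eq0 x : kil x (theta x) = 0 -> x = 0.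
Proof.
move=> h; apply/eqP/negPn/negP => x0.
by case: Htheta => _ _ _ _ /(_ x x0); rewrite h ltxx.
Qed.

Lemma kil_nondeg x : (forall y, kil x y = 0) -> x = 0.
Proof. by move=> h; apply: kil_theta_eq0. Qed.

Lemma kil_real_eq0 h : theta h = - h -> kil h h = 0 -> h = 0.
Proof. by move=> th hh; apply: kil_theta_eq0; rewrite th kilNr // hh oppr0. Qed.

(** Orthogonal projection to [W] for the form [kil x (theta y)]. [B *m M] is the Gram matrix of a
    basis of [W], invertible because the form is definite. *)
Lemma orth_decomposition (W : 'M[C]_d) y : exists y1 y2,
  [/\ y = y1 + y2, (y1 <= W)%MS &
      forall z, (z <= W)%MS -> kil y2 (theta z) = 0].
Proof.
pose B := row_base W; pose t j := theta (row j B).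
pose M : 'M[C]_(d, \rank W) := \matrix_(i, j) kil (delta_mx 0 i) (t j).
have ME (u : 'rV_d) j : (u *m M) 0 j = kil u (t j).
  rewrite mxE [u in RHS]row_sum_delta kil_suml //; apply: eq_bigr => i _.
  by rewrite kilZl // mxE.
have thW z : (z <= W)%MS -> exists v : 'rV_(\rank W), z = v *m B /\
    theta z = \sum_j (v 0 j)^* *: t j.
  rewrite -(eq_row_base W) => /submxP[v ->]; exists v; split => //.
  rewrite mulmx_sum_row theta_sum;
   by apply: eq_bigr => j _; rewrite thetaZ.
have thWM z u : (z <= W)%MS -> u *m M = 0 -> kil u (theta z) = 0.
  move=> /thW[v [_ ->]] uM; rewrite kil_sumr // big1 // => j _.
  by rewrite kilZr // -ME uM mxE mulr0.
have : row_free (B *m M).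
  apply: inj_row_free => v; rewrite mulmxA => vBM.
  have zW : (v *m B <= W)%MS by rewrite -(eq_row_base W) submxMl.
  have := kil_theta_eq0 (thWM _ _ zW vBM).
  move=> vB; apply: (row_free_inj (row_base_free W)).
  by rewrite -/B vB mul0mx.
rewrite row_free_unit => GU.
(* Chosen so that [y1 *m M = y *m M]: then [y - y1] pairs to zero with every [t j]. *)
pose y1 := y *m M *m invmx (B *m M) *m B.
exists y1, (y - y1); split; first by rewrite addrC subrK.
  by rewrite -(eq_row_base W) submxMl.
move=> z zW; apply: thWM => //.
by rewrite mulmxBl /y1 -[_ *m B *m M]mulmxA mulmxKV // subrr.
Qed.

End CartanConj.

Lemma scalar_mx1_inj (K : pzRingType) (a b : K) : a%:M = b%:M :> 'M[K]_1 -> a = b.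
Proof. by move/(congr1 mxtrace); rewrite !mxtrace_scalar. Qed.

Section ExpAutomorphism.
Variables (R : realType) (d : nat) (br : 'rV[R[i]]_d -> 'rV[R[i]]_d -> 'rV[R[i]]_d).
Hypothesis Hlie : lie_algebra br.
Local Notation C := R[i].
Local Notation kil := (killing br).

Lemma exp_ad_br x y z :
  br (y *m expmx (ad br x)) (z *m expmx (ad br x)) = br y z *m expmx (ad br x).
Proof.
apply: bil_expmx; [exact: br_bilinl|exact: br_bilinr|].
by move=> u v; rewrite !mul_ad // [RHS]br_jacobi.
Qed.

Lemma exp_ad_kil x y z :
  kil (y *m expmx (ad br x)) (z *m expmx (ad br x)) = kil y z.
Proof.
(* The form is read in 1x1 matrices to fit [bil_expmx]; its invariance under [ad br x] is [betaA]
   with [B = 0]. *)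
pose beta (u v : 'rV[C]_d) : 'rV[C]_1 := (kil u v)%:M.
have l a u v w : beta (a *: u + v) w = a *: beta u w + beta v w.
  by rewrite /beta kil_bilinl // raddfD /= scale_scalar_mx.
have r a u v w : beta u (a *: v + w) = a *: beta u v + beta u w.
  by rewrite /beta kil_bilinr // raddfD /= scale_scalar_mx.
have D u v : beta (u *m ad br x) v + beta u (v *m ad br x) = beta u v *m 0.
  by rewrite mulmx0 /beta -raddfD /= !mul_ad // kil_inv2 // addNr raddf0.
have := bil_expmx l r D y z; rewrite expmx0 mulmx1.
exact: scalar_mx1_inj.
Qed.

Variable theta : 'rV[C]_d -> 'rV[C]_d.
Hypothesis Htheta : cartan_conj br theta.

(** An isometry of a nondegenerate form is injective. *)
Lemma exp_ad_unit x : expmx (ad br x) \in unitmx.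
Proof.
rewrite -row_free_unit; apply: inj_row_free => v vE.
apply: (kil_nondeg Htheta) => y.
by rewrite -(exp_ad_kil x) vE kil0l.
Qed.

Lemma ad_exp_expn x e n :
  let g := expmx (ad br x) in
  ad br (e *m g) ^+ n = invmx g *m ad br e ^+ n *m g.
Proof.
move=> g; have gU : g \in unitmx := exp_ad_unit x.
have E : g *m ad br (e *m g) = ad br e *m g.
  by apply: mx_rowP => y; rewrite !mulmxA !mul_ad // exp_ad_br.
elim: n => [|n IH]; first by rewrite !expr0 mulmx1 mulVmx.
by rewrite mxpowSr IH -[LHS]mulmxA E [in RHS]mxpowSr !mulmxA.
Qed.

Lemma orbit_height_adj_orbit e e' n :
  adj_orbit br e e' -> orbit_height br e n -> orbit_height br e' n.
Proof.
elim=> // y x _ IH /IH [yn ym]; split => [|m nm]; last first.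
  by rewrite ad_exp_expn ym // mulmx0 mul0mx.
have gU := exp_ad_unit x.
apply: contra yn; rewrite ad_exp_expn => /eqP/(congr1 (mulmx (expmx (ad br x)))).
rewrite !mulmxA mulmxV // mul1mx mulmx0 => /(congr1 (mulmxr (invmx (expmx (ad br x))))).
by rewrite /= mulmxK // mul0mx => ->.
Qed.

End ExpAutomorphism.

(** * The conjugation of a compact real form *)

Section CompactForm.
Variables (C : numClosedFieldType) (d : nat) (br : 'rV[C]_d -> 'rV[C]_d -> 'rV[C]_d).
Hypothesis Hlie : lie_algebra br.
Local Notation kil := (killing br).

(** The conjugation changes the sign of ['i *: y] in the decomposition [x + 'i *: y] along [k],
    which [uniq] makes unambiguous. *)
Lemma compact_form_conj (k : 'rV[C]_d -> Prop) :
  [/\ k 0, (forall x y, k x -> k y -> k (x + y)),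
      (forall (a : C) x, a \is Num.real -> k x -> k (a *: x)) &
      (forall x y, k x -> k y -> k (br x y))] ->
  [/\ (forall z, exists x y, [/\ k x, k y & z = x + 'i *: y]),
      (forall x, k x -> k ('i *: x) -> x = 0) &
      (forall x, k x -> x != 0 -> kil x x < 0)] ->
  exists theta, cartan_conj br theta /\
    forall h, (exists x, k x /\ h = 'i *: x) <-> theta h = - h.
Proof.
move=> [k0 kD kZ kbr] [kdec kI kneg].
have kN x : k x -> k (- x) by move=> kx; rewrite -scaleN1r; apply: kZ; rewrite ?rpredN1.
have kB x y : k x -> k y -> k (x - y) by move=> kx ky; apply: kD => //; exact: kN.
have uniq x y x' y' : k x -> k y -> k x' -> k y' ->
    x + 'i *: y = x' + 'i *: y' -> x = x' /\ y = y'.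
  move=> kx ky kx' ky' E.
  have E2 : x - x' = 'i *: (y' - y).
    by apply/eqP; rewrite scalerBr subr_eq addrAC -subr_eq opprK E addrC.
  have y0 : y' - y = 0 by apply: kI; [exact: kB|rewrite -E2; exact: kB].
  move: E2; rewrite y0 scaler0 => /eqP; rewrite subr_eq0 => /eqP ->.
  by split => //; apply/esym/eqP; rewrite -subr_eq0 y0.
pose P z (xy : 'rV[C]_d * 'rV[C]_d) := [/\ k xy.1, k xy.2 & z = xy.1 + 'i *: xy.2].
have Pex z : exists xy, P z xy by have [x [y h]] := kdec z; exists (x, y).
pose D z := sval (cid (Pex z)).
have DP z : P z (D z) by rewrite /D; case: cid.
pose theta z := (D z).1 - 'i *: (D z).2.
have thE x y : k x -> k y -> theta (x + 'i *: y) = x - 'i *: y.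
  move=> kx ky; have [k1 k2 E] := DP (x + 'i *: y).
  by have [E1 E2] := uniq _ _ _ _ kx ky k1 k2 E; rewrite /theta -E1 -E2.
have ii : 'i * 'i = -1 :> C by rewrite -expr2 sqrCi.
exists theta; split; last first.
  move=> h; split => [[x [kx ->]]|].
    by have := thE 0 x k0 kx; rewrite !add0r.
  have [x [y [kx ky ->]]] := kdec h; rewrite thE // opprD => /addIr xx.
  exists y; split => //; suff -> : x = 0 by rewrite add0r.
  move/eqP: xx; rewrite -subr_eq0 opprK -mulr2n -scaler_nat scaler_eq0.
  by rewrite pnatr_eq0 => /eqP.
(* Polarization: the form is real on the diagonal of [k], hence on all pairs. *)
have kilR x y : k x -> k y -> kil x y \is Num.real.
  move=> kx ky.
  have kilxx z : k z -> kil z z \is Num.real.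
    move=> kz; case: (eqVneq z 0) => [->|z0]; first by rewrite kil0l ?rpred0.
    by apply: ltr0_real; exact: kneg.
  have := kilxx _ (kD _ _ kx ky); rewrite kilDl // !kilDr // (kilC br y x).
  move=> h; have : kil x y + kil x y \is Num.real.
    have -> : kil x y + kil x y = kil x x + kil x y + (kil x y + kil y y)
        - kil x x - kil y y by ring.
    by rewrite !rpredB ?kilxx.
  rewrite -mulr2n -mulr_natr => h2.
  have -> : kil x y = kil x y * 2%:R / 2%:R by rewrite mulfK // pnatr_eq0.
  by rewrite rpredM // rpredV realn.
have cR a : a \is Num.real -> (a^* = a :> C)%R by move/CrealP.
have cI : ('i^* = - 'i :> C)%R by exact: conjCi.
have kilI x y x' y' : kil (x + 'i *: y) (x' + 'i *: y') =
    kil x x' - kil y y' + 'i * (kil x y' + kil y x').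
  rewrite !kilDl // !kilDr // !kilZl // !kilZr // mulrA ii.
  by ring.
have kilI' x y x' y' : kil (x - 'i *: y) (x' - 'i *: y') =
    kil x x' - kil y y' - 'i * (kil x y' + kil y x').
  by rewrite -(scalerN 'i y) -(scalerN 'i y') kilI !kilNl // !kilNr //; ring.
split.
- move=> a x y; have [x1 [x2 [k1 k2 ->]]] := kdec x.
  have [y1 [y2 [h1 h2 ->]]] := kdec y.
  have [u [v [uR vR ->]]] : exists u v : C, [/\ u \is Num.real, v \is Num.real & a = u + 'i * v].
    by exists ('Re a), ('Im a); rewrite Creal_Re Creal_Im -Crect.
  rewrite rmorphD rmorphM /= (cR u) // (cR v) // cI.
  have -> : (u + 'i * v) *: (x1 + 'i *: x2) + (y1 + 'i *: y2) =
      (u *: x1 - v *: x2 + y1) + 'i *: (v *: x1 + u *: x2 + y2).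
    by apply/rowP => j; rewrite !mxE; ring: ii.
  rewrite !thE //; first by apply/rowP => j; rewrite !mxE; ring: ii.
    by apply: kD => //; apply: kB; exact: kZ.
  by apply: (kD) => //; apply: kD; exact: kZ.
- move=> x; have [x1 [x2 [k1 k2 ->]]] := kdec x.
  by rewrite thE // -scalerN thE ?scalerN ?opprK //; exact: kN.
- move=> x y; have [x1 [x2 [k1 k2 ->]]] := kdec x.
  have [y1 [y2 [h1 h2 ->]]] := kdec y.
  rewrite !thE //.
  have -> : br (x1 + 'i *: x2) (y1 + 'i *: y2) =
     (br x1 y1 - br x2 y2) + 'i *: (br x1 y2 + br x2 y1).
    rewrite !(brDl Hlie) !(brDr Hlie) !(brZl Hlie) !(brZr Hlie) scalerA ii scaleN1r scalerDr.
    by apply/rowP => j; rewrite !mxE; ring.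
  rewrite thE; [|by apply: kB; exact: kbr|by apply: kD; exact: kbr].
  rewrite !(brBl Hlie) !(brBr Hlie) !(brZl Hlie) !(brZr Hlie) scalerA ii scaleN1r scalerDr.
  by apply/rowP => j; rewrite !mxE; ring.
- move=> x y; have [x1 [x2 [k1 k2 ->]]] := kdec x.
  have [y1 [y2 [h1 h2 ->]]] := kdec y.
  rewrite !thE // kilI' kilI rmorphD rmorphM /= cI !cR ?mulNr //.
    by apply: rpredD; exact: kilR.
  by apply: rpredB; exact: kilR.
- move=> x; have [x1 [x2 [k1 k2 ->]]] := kdec x => x0.
  (* The cross terms cancel, leaving [kil x1 x1 + kil x2 x2]. *)
  rewrite thE // -scalerN kilI kilNr // opprK kilNr // (kilC br x2 x1) addNr mulr0 addr0.
  case: (eqVneq x1 0) x0 => [->|x10 _].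
    rewrite add0r kil0l // add0r scaler_eq0 negb_or => /andP[_ x20]; exact: kneg.
  case: (eqVneq x2 0) => [->|x20]; first by rewrite kil0l // addr0; exact: kneg.
  by rewrite -(addr0 0); apply: ltrD; exact: kneg.
Qed.

End CompactForm.

Lemma compact_real_form_conj (R : realType) d (br : 'rV[R[i]]_d -> 'rV[R[i]]_d -> 'rV[R[i]]_d)
    (k : 'rV[R[i]]_d -> Prop) : lie_algebra br -> compact_real_form br k ->
  exists theta, cartan_conj br theta /\ forall h, in_ik k h <-> theta h = - h.
Proof. by move=> Hlie [Hk1 Hk2]; exact: (compact_form_conj Hlie Hk1 Hk2). Qed.

(** * Height of a Moore-Penrose orbit *)

Ltac row_ring := apply/rowP => ?; rewrite !mxE; ring.

(** * Commutation rules of sl2 and uniqueness of self-adjoint triples *)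

Section Sl2.
Variables (C : numClosedFieldType) (d : nat) (br : 'rV[C]_d -> 'rV[C]_d -> 'rV[C]_d).
Hypothesis Hlie : lie_algebra br.
Local Notation kil := (killing br).
Implicit Types e f h x y z v w : 'rV[C]_d.

Lemma ad_powS e n w : w *m ad br e ^+ n.+1 = br e (w *m ad br e ^+ n).
Proof. by rewrite mxpowSr mulmxA mul_ad. Qed.

Lemma ad_pow0 e w : w *m ad br e ^+ 0 = w.
Proof. by rewrite expr0 mulmx1. Qed.

(** The rule [e^(n+1) f = f e^(n+1) + (n+1) (h - n) e^n] of the enveloping algebra. Assuming just
    two of the relations lets it apply before a triple is completed. *)
Lemma ad_pow_comm e h f n w : br e f = h -> br h e = 2%:R *: e ->
  br f w *m ad br e ^+ n.+1 = br f (w *m ad br e ^+ n.+1) +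
    n.+1%:R *: (br h (w *m ad br e ^+ n) - n%:R *: (w *m ad br e ^+ n)).
Proof.
move=> ef he.
have efE v : br e (br f v) = br h v + br f (br e v) by rewrite (br_jacobi Hlie) ef.
have ehE v : br e (br h v) = br h (br e v) - 2%:R *: br e v.
  by rewrite (br_jacobi Hlie) (brC Hlie e h) he (brNl Hlie) (brZl Hlie) addrC.
elim: n => [|n IH].
  by rewrite ad_powS !ad_pow0 ad_powS ad_pow0 efE scale0r subr0 scale1r addrC.
rewrite ad_powS IH (brDr Hlie) (brZr Hlie) (brBr Hlie) (brZr Hlie) efE ehE -!ad_powS.
row_ring.
Qed.

(* Vectors of weight -2 killed by [e] vanish: in an sl2-module highest weights are
   nonnegative, as [e f^n z] is a nonzero multiple of [f^(n-1) z]. *)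
Lemma weight_m2_highest e h f z : sl2_triple br e h f -> ad br e ^+ 3 = 0 ->
  br e z = 0 -> br h z = - (2%:R *: z) -> z = 0.
Proof.
move=> [ef he hf] e3 ez hz.
have efE v : br e (br f v) = br h v + br f (br e v) by rewrite (br_jacobi Hlie) ef.
have hfE v : br h (br f v) = br f (br h v) - 2%:R *: br f v.
  by rewrite (br_jacobi Hlie) hf (brNl Hlie) (brZl Hlie) addrC.
have E1 : br e (br f z) = - (2%:R *: z) by rewrite efE ez (br0r Hlie) addr0.
have H1 : br h (br f z) = - (4%:R *: br f z).
  by rewrite hfE hz (brNr Hlie) (brZr Hlie); row_ring.
have E2 : br e (br f (br f z)) = - (6%:R *: br f z).
  by rewrite efE E1 H1 (brNr Hlie) (brZr Hlie); row_ring.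
have H2 : br h (br f (br f z)) = - (6%:R *: br f (br f z)).
  by rewrite hfE H1 (brNr Hlie) (brZr Hlie); row_ring.
have E3 : br e (br f (br f (br f z))) = - (12%:R *: br f (br f z)).
  by rewrite efE E2 H2 (brNr Hlie) (brZr Hlie); row_ring.
(* Applying [e] three times to [f^3 z] gives [(-12) (-6) (-2) z = -144 z]. *)
have : br f (br f (br f z)) *m ad br e ^+ 3 = 0 by rewrite e3 mulmx0.
rewrite !ad_powS ad_pow0 E3 !(brNr Hlie, brZr Hlie) E2 !(brNr Hlie, brZr Hlie) E1.
rewrite !scalerN !scalerA -!natrM => /eqP.
by rewrite !opprK oppr_eq0 scaler_eq0 pnatr_eq0 /= => /eqP.
Qed.

Variable theta : 'rV[C]_d -> 'rV[C]_d.
Hypothesis Htheta : cartan_conj br theta.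

(** [kil_neutral] makes [h - h'] isotropic, while the Killing form is definite on the vectors that
    [theta] negates. *)
Lemma neutral_unique e h f h' f' :
  sl2_triple br e h f -> sl2_triple br e h' f' ->
  theta h = - h -> theta h' = - h' -> h = h'.
Proof.
move=> t t' th th'; apply/eqP; rewrite -subr_eq0; apply/eqP.
apply: (kil_real_eq0 Hlie Htheta); first by rewrite (thetaB Htheta) th th' opprD.
have [h1 h2] := kil_neutral Hlie t t'.
by rewrite kilBl // h1 h2 subrr.
Qed.

(** Once [h = h'], the vector [f - f'] is killed by [e] and has weight -2. *)
Lemma sl2_triple_unique e h f h' f' : ad br e ^+ 3 = 0 ->
  sl2_triple br e h f -> sl2_triple br e h' f' ->
  theta h = - h -> theta h' = - h' -> h = h' /\ f = f'.
Proof.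
move=> e3 t t' th th'; have hh' := neutral_unique t t' th th'; split => //.
apply/eqP; rewrite -subr_eq0; apply/eqP; apply: (weight_m2_highest t e3).
  by case: t t' => ef _ _ [ef' _ _]; rewrite (brBr Hlie) ef ef' hh' subrr.
case: t t' => _ _ hf [_ _ hf'].
by rewrite (brBr Hlie) {2}hh' hf hf'; row_ring.
Qed.

End Sl2.

(** Isolates what the height argument takes from [exp (ad x)], apart from its value on vectors
    killed by [ad(x)^2]. *)
Definition killing_aut (C : fieldType) d (br : 'rV[C]_d -> 'rV[C]_d -> 'rV[C]_d)
    (g : 'M[C]_d) : Prop :=
  [/\ g \in unitmx,
      (forall y z, br (y *m g) (z *m g) = br y z *m g) &
      (forall y z, killing br (y *m g) (z *m g) = killing br y z)].

Section MoorePenroseHeight.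
Variables (C : numClosedFieldType) (d : nat) (br : 'rV[C]_d -> 'rV[C]_d -> 'rV[C]_d).
Hypothesis Hlie : lie_algebra br.
Local Notation kil := (killing br).
Variable theta : 'rV[C]_d -> 'rV[C]_d.
Hypothesis Htheta : cartan_conj br theta.

(* For [g = exp (ad x)]: both [h g = h - c x] and the self-adjoint [h'] are neutral elements
   of [e g], and the orthogonality relations force [h' = h]; so [c x] commutes with [e g]. *)
Lemma neutral_conj_commute (g : 'M[C]_d) e h f x w c : killing_aut br g ->
  (forall y, br x (br x y) = 0 -> y *m g = y + br x y) ->
  sl2_triple br e h f -> theta h = - h -> x = br e w -> br h x = c *: x -> c != 0 ->
  (exists h' f', sl2_triple br (e *m g) h' f' /\ theta h' = - h') ->
  br x e = 0.
Proof.
move=> [gU gbr gkil] gE t th xE hx c0 [h' [f' [t' th']]].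
have t'' : sl2_triple br (e *m g) (h *m g) (f *m g).
  case: t => [ef he hf]; split; rewrite gbr.
  - by rewrite ef.
  - by rewrite he scalemxAl.
  - by rewrite hf mulNmx scalemxAl.
have xg : x *m g = x by rewrite gE (brxx Hlie) ?(br0r Hlie) ?addr0.
have xh : br x h = - (c *: x) by rewrite (brC Hlie) hx.
(* [[x, h] = - c x] commutes with [x], so [gE] gives the exact image of [h]. *)
have hg : h *m g = h - c *: x.
  rewrite gE xh // (brNr Hlie) (brZr Hlie) (brxx Hlie).
  by rewrite scaler0 oppr0.
have [k1 k2] := kil_neutral Hlie t'' t'.
have k3 : kil (h *m g) (h *m g) = kil h h by exact: gkil.
have k4 : kil h x = 0.
  by apply: (mulfI c0); rewrite mulr0 -kilZr // -hx -kil_inv // (brxx Hlie) kil0l.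
have k5 : kil x x = 0.
  by apply: (kil_weight Hlie hx hx); rewrite -mulr2n mulrn_eq0.
(* [x = x *m g] lies in the image of [ad br (e *m g)] and [h *m g - h'] in its kernel. *)
have k6 : kil x (h *m g - h') = 0.
  have [eg heg _] := t''; have [eg' heg' _] := t'.
  rewrite -[x in kil x]xg {1}xE -gbr kil_inv2 //.
  have -> : br (e *m g) (h *m g - h') = 0.
    by rewrite (brBr Hlie) !(brC Hlie (e *m g)) heg heg' subrr.
  by rewrite kil0r // oppr0.
(* With [kil x h' = 0], the relations [k1] and [k2] become [kil h h = kil h h' = kil h' h'], so
   [h' - h] is isotropic. *)
have hh' : h' = h.
  apply/eqP; rewrite -subr_eq0; apply/eqP.
  apply: (kil_real_eq0 Hlie Htheta); first by rewrite (thetaB Htheta) th th' opprD.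
  move: k1 k2 k3 k6; rewrite hg !kilBr // !kilBl // !kilZl // !kilZr //.
  rewrite k5 (kilC br x h) k4 !mulr0 !subr0 sub0r (kilC br h' h).
  rewrite (kilC br h' x).
  set a := kil h h; set b := kil h h'; set q := kil x h'; set r := kil h' h'.
  move=> k1 k2 _ /eqP; rewrite oppr_eq0 => /eqP q0; move: k1 k2; rewrite q0 !mulr0 !subr0.
  move=> /eqP; rewrite subr_eq0 => /eqP -> /eqP; rewrite subr_eq0 => /eqP ->.
  by rewrite subrr.
have [_ heg _] := t''; have [_ heg' _] := t'.
have : c *: br x (e *m g) = 0.
  rewrite -(brZl Hlie); have -> : c *: x = h' - h *m g by rewrite hg hh' opprB addrC subrK.
  by rewrite (brBl Hlie) heg heg' subrr.
move/eqP; rewrite scaler_eq0 (negPf c0) /= -{1}xg gbr => /eqP xe.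
by rewrite -(mulmxK gU (br x e)) xe mul0mx.
Qed.

Lemma moore_penrose_height e : e != 0 -> ad_nilpotent br e ->
  (exists h f, sl2_triple br e h f /\ theta h = - h) ->
  (forall x, exists g : 'M[C]_d, [/\ killing_aut br g,
     (forall y, br x (br x y) = 0 -> y *m g = y + br x y) &
     exists h' f', sl2_triple br (e *m g) h' f' /\ theta h' = - h']) ->
  orbit_height br e 2.
Proof.
move=> e0 [n0 n0E] [h [f [t th]]] MP.
have [ef he hf] := t.
have exn : exists n, ad br e ^+ n == 0 by exists n0; apply/eqP.
have [n /eqP nE nmin] := ex_minnP exn.
have efE v : br e (br f v) = br h v + br f (br e v) by rewrite (br_jacobi Hlie) ef.
have hfE v : br h (br f v) = br f (br h v) - 2%:R *: br f v.
  by rewrite (br_jacobi Hlie) hf (brNl Hlie) (brZl Hlie) addrC.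
have E2 : ad br e ^+ 2 != 0.
  apply/eqP => E2; have : f *m ad br e ^+ 2 = 0 by rewrite E2 mulmx0.
  rewrite !ad_powS // ad_pow0 ef (brC Hlie) he => /eqP.
  by rewrite oppr_eq0 scaler_eq0 pnatr_eq0 (negPf e0).
have pow0 m : (n <= m)%N -> ad br e ^+ m = 0.
  by move=> nm; rewrite -(subnKC nm) exprD nE mul0r.
have n2 : (2 < n)%N by rewrite ltnNge; apply: contra E2 => /pow0 ->.
(* Nilpotency index 3 gives height 2 at once. Henceforth the index is [n.+4], so that [N = n.+3] is
   at least 3. *)
case: n n2 nE nmin pow0 => [|[|[|[|n]]]] // _ nE nmin _.
have EN : ad br e ^+ n.+3 != 0.
  by apply/negP => /nmin; rewrite ltnn.
have [w vN0] : exists w : 'rV[C]_d, w *m ad br e ^+ n.+3 != 0.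
  apply: contrapT => /forallNP hw; move/eqP: EN => EN; apply: EN.
  by apply: mx_rowP => y; rewrite mulmx0; apply/eqP/negPn/negP; exact: hw.
set v := w *m _ in vN0.
have ev : br e v = 0 by rewrite -ad_powS // nE mulmx0.
(* Since [ad(e)^(N+1) = 0], the commutation rule reduces to [(N + 1) (h - N) v = 0]. *)
have hv : br h v = n.+3%:R *: v.
  have := ad_pow_comm Hlie n.+3 w ef he.
  rewrite nE !mulmx0 br0r // add0r => /esym/eqP; rewrite scaler_eq0 pnatr_eq0 /=.
  by rewrite subr_eq0 => /eqP.
pose x := br f v.
have ex : br e x = n.+3%:R *: v by rewrite /x efE hv ev (br0r Hlie) addr0.
have hx : br h x = n.+1%:R *: x.
  rewrite /x hfE hv (brZr Hlie) -scalerBl; congr (_ *: _).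
  by rewrite -natrB //; congr (_%:R).
have efx : br e (br f x) = (n.+1 + n.+3)%:R *: x.
  by rewrite efE hx ex (brZr Hlie) -scalerDl natrD.
have m0 : ((n.+1 + n.+3)%:R : C) != 0 by rewrite pnatr_eq0.
(* [e f x = (N - 2 + N) x], with a nonzero coefficient, exhibits [x] in the image of [ad br e]. *)
have xE : x = br e ((n.+1 + n.+3)%:R^-1 *: br f x).
  by rewrite (brZr Hlie) efx scalerA mulVf // scale1r.
have c0 : (n.+1%:R : C) != 0 by rewrite pnatr_eq0.
have [g [gA gE gT]] := MP x.
have := neutral_conj_commute gA gE t th xE hx c0 gT.
rewrite (brC Hlie) ex => /eqP.
by rewrite oppr_eq0 scaler_eq0 pnatr_eq0 (negPf vN0).
Qed.

End MoorePenroseHeight.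

(** * Self-adjoint neutral elements at height two *)

(** The relation on [E] and [Z] says [[E, [E, Z]] = 0]. Together with [E^3 = 0] it makes the word
    [E Z E E] vanish, and doubling reduces [(E Z)^4] to words containing it. *)
Lemma nilp_of_double_comm (A : pzRingType) (E Z : A) :
  (forall a : A, a *+ 2 = 0 -> a = 0) -> (forall a : A, a *+ 3 = 0 -> a = 0) ->
  E * E * E = 0 -> (E * Z * E) *+ 2 = E * E * Z + Z * E * E -> (E * Z) ^+ 4 = 0.
Proof.
move=> h2 h3 E3 rel.
have E3r X : X * E * E * E = 0 by rewrite -!mulrA [E * (E * E)]mulrA E3 mulr0.
have EEZE : E * E * Z * E = (E * Z * E * E) *+ 2.
  by rewrite -mulrnAl rel mulrDl E3r addr0.
have EEZE' : (E * E * Z * E) *+ 2 = E * Z * E * E.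
  have /= := congr1 (fun t => E * t) rel; rewrite [RHS]mulrDr !mulrA E3 mul0r add0r => <-.
  by rewrite mulrnAr !mulrA.
(* The two relations above give [E Z E E = 4 (E Z E E)], and there is no 3-torsion. *)
have EZEE : E * Z * E * E = 0.
  apply: h3; apply: (addrI (E * Z * E * E)).
  by rewrite addr0 -mulrS -[in RHS]EEZE' EEZE -mulrnA.
have Y : E * E * Z * Z * E = E * Z * Z * E * E.
  transitivity ((E * Z * E * Z * E) *+ 2).
    rewrite -mulrnAl -mulrnAl rel !mulrDl -(mulrA Z) -(mulrA Z) -(mulrA Z).
    by rewrite EEZE EZEE mul0rn mulr0 addr0.
  have /= := congr1 (fun t => E * Z * t) rel; rewrite [RHS]mulrDr !mulrA EZEE mul0r add0r => <-.
  by rewrite mulrnAr !mulrA.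
have A2 : (E * Z * E * Z) *+ 2 = E * E * Z * Z + Z * E * E * Z.
  by rewrite -mulrnAl rel mulrDl.
apply: h2; rewrite !exprS expr0 mulr1 !mulrA.
have -> : E * Z * E * Z * E * Z * E * Z = E * Z * (E * Z * (E * Z * E * Z)).
  by rewrite !mulrA.
have A3 : E * Z * (E * E * Z * Z + Z * E * E * Z) = E * E * Z * Z * E * Z.
  by rewrite mulrDr !mulrA EZEE !mul0r add0r -Y.
by rewrite -mulrnAr -mulrnAr A2 A3 !mulrA EZEE !mul0r.
Qed.

Section Existence.
Variables (C : numClosedFieldType) (d : nat) (br : 'rV[C]_d -> 'rV[C]_d -> 'rV[C]_d).
Hypothesis Hlie : lie_algebra br.
Local Notation kil := (killing br).
Implicit Types e f h x y z v w : 'rV[C]_d.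

(** In matrices the assumption on [z] reads [[E, [E, Z]] = 0], so [E Z] is nilpotent and its trace,
    the Killing form, vanishes. *)
Lemma kil_double_comm e z : ad br e ^+ 3 = 0 -> br e (br e z) = 0 -> kil e z = 0.
Proof.
move=> E3 eez; rewrite /killing; apply: (@trace_nilpotent _ _ _ 4).
have h n (a : 'M[C]_d) : a *+ n.+1 = 0 -> a = 0.
  rewrite -scaler_nat => /eqP; rewrite scaler_eq0 pnatr_eq0 /= => /eqP; exact.
apply: (@nilp_of_double_comm 'M[C]_d (ad br e) (ad br z)) => [a|a||].
- exact: (h 1%N).
- exact: (h 2%N).
- by rewrite -E3 !exprS expr0 mulr1 mulrA.
have brE a b y : br (br a b) y = br a (br b y) - br b (br a y).
  by rewrite (br_jacobi Hlie a b y) addrK.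
apply: mx_rowP => y; rewrite -scaler_nat -scalemxAr mulmxDr !mulmxA !(mul_ad Hlie).
have := brE e (br e z) y; rewrite eez (br0l Hlie) !brE (brBr Hlie).
move=> /esym/eqP; rewrite opprB addrA subr_eq0 => /eqP Q.
by rewrite scaler_nat mulr2n -{1}Q addrAC subrK addrC.
Qed.

(** [e^2 f^2 v = 2 (h - 1) h v] when [e] kills [v], and [h] acts as 2 on the image of [ad(e)^2]
    because [ad(e)^3 = 0]. So [h (h - 1) (h - 2)] kills [v]. *)
Lemma ker_e_cubic e h f v : br e f = h -> br h e = 2%:R *: e -> ad br e ^+ 3 = 0 ->
  br e v = 0 -> br h (br h (br h v)) = 3%:R *: br h (br h v) - 2%:R *: br h v.
Proof.
move=> ef he E3 ev.
have hE2 w : br h (br e (br e w)) = 2%:R *: br e (br e w).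
  have := ad_pow_comm Hlie 2 w ef he.
  rewrite E3 !mulmx0 (br0r Hlie) add0r => /esym/eqP.
  rewrite scaler_eq0 pnatr_eq0 /= !(ad_powS Hlie) ad_pow0 subr_eq0 => /eqP //.
have E2f w : br e (br e (br f w)) = br f (br e (br e w)) +
    2%:R *: (br h (br e w) - br e w).
  by have := ad_pow_comm Hlie 1 w ef he; rewrite !(ad_powS Hlie) !ad_pow0 scale1r.
have efv : br e (br f v) = br h v.
  by rewrite (br_jacobi Hlie) ef ev (br0r Hlie) addr0.
have E2fv : br e (br e (br f v)) = 0.
  by rewrite E2f ev !(br0r Hlie) subrr scaler0 addr0.
have := E2f (br f v); rewrite E2fv (br0r Hlie) add0r efv => Q.
have := hE2 (br f (br f v)); rewrite Q (brZr Hlie) (brBr Hlie) scalerA mulrC -scalerA.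
have n2 : (2%:R : C) != 0 by rewrite pnatr_eq0.
by move=> /(scalerI n2)/eqP; rewrite subr_eq => /eqP ->; row_ring.
Qed.

(** [f0] may be changed by any element killed by [e]. The defect [y] of the relation for [[h, f0]]
    is such an element, and [ad h + 2] is invertible on them since [h (h - 1) (h - 2) = 0] there. *)
Lemma sl2_triple_complete e h f0 : br e f0 = h -> br h e = 2%:R *: e ->
  ad br e ^+ 3 = 0 -> exists f, sl2_triple br e h f.
Proof.
move=> ef he E3.
have ehE v : br e (br h v) = br h (br e v) - 2%:R *: br e v.
  by rewrite (br_jacobi Hlie) (brC Hlie e h) he (brNl Hlie) (brZl Hlie) addrC.
pose y := br h f0 + 2%:R *: f0.
have ey : br e y = 0.
  by rewrite /y (brDr Hlie) ehE ef (brxx Hlie) (brZr Hlie) ef sub0r addNr.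
have ehy : br e (br h y) = 0 by rewrite ehE ey (br0r Hlie) scaler0 subr0.
have ehhy : br e (br h (br h y)) = 0 by rewrite ehE ehy (br0r Hlie) scaler0 subr0.
have hhhy := ker_e_cubic ef he E3 ey.
(* X (X - 1) (X - 2) = (X + 2) (X^2 - 5 X + 12) - 24, hence [z] inverts [ad h + 2] at [y]. *)
pose z := 24%:R^-1 *: (br h (br h y) - 5%:R *: br h y + 12%:R *: y).
have ez : br e z = 0.
  rewrite /z (brZr Hlie) (brDr Hlie) (brBr Hlie) !(brZr Hlie) ey ehy ehhy.
  by rewrite !scaler0 subr0 addr0 scaler0.
have hz : br h z + 2%:R *: z = y.
  rewrite /z (brZr Hlie) (brDr Hlie) (brBr Hlie) !(brZr Hlie) hhhy.
  by apply/rowP => j; rewrite !mxE; field.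
exists (f0 - z); split => //; first by rewrite (brBr Hlie) ef ez subr0.
have hf0 : br h f0 = y - 2%:R *: f0 by rewrite /y addrK.
by rewrite (brBr Hlie) hf0 -{1}hz; row_ring.
Qed.

(** * Weight filtration of a triple with [ad(e)^3 = 0] *)

Section Filtration.
Variables (e h0 f0 : 'rV[C]_d).
Hypothesis t0 : sl2_triple br e h0 f0.
Hypothesis E3 : ad br e ^+ 3 = 0.

(* Indices are weights shifted by 2, so that [fil 0] is everything and [fil 5] is zero. *)
Definition wt (i : nat) v := br h0 v = (i%:R - 2%:R) *: v.

Definition fil (j : nat) : 'M[C]_d :=
  (\sum_(i < 5 | (j <= i)%N) eigenspace (ad br h0) (i%:R - 2%:R))%MS.

Lemma wtP i v : reflect (wt i v) (v <= eigenspace (ad br h0) (i%:R - 2%:R))%MS.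
Proof. by apply: (iffP eigenspaceP) => h; move: h; rewrite (mul_ad Hlie). Qed.

Lemma wt_fil i j v : (j <= i)%N -> (i < 5)%N -> wt i v -> (v <= fil j)%MS.
Proof.
move=> ji i5 /wtP vi; apply: submx_trans vi _.
by apply: (sumsmx_sup (Ordinal i5)).
Qed.

Lemma fil_ind (P : 'rV[C]_d -> Prop) j : P 0 -> (forall x y, P x -> P y -> P (x + y)) ->
  (forall i x, (j <= i)%N -> (i < 5)%N -> wt i x -> P x) ->
  forall x, (x <= fil j)%MS -> P x.
Proof.
move=> P0 PD Pw x /sub_sumsmxP[u ->].
elim/big_ind: _ => // i ji; apply: (Pw i) => //.
by apply/wtP; exact: submxMl.
Qed.

Lemma fil_succ j x : (x <= fil j)%MS -> (j < 5)%N ->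
  exists x1 x2, [/\ x = x1 + x2, wt j x1 & (x2 <= fil j.+1)%MS].
Proof.
move=> xj j5; move: x xj; apply: fil_ind => [|x y|i x ji i5 wx].
- by exists 0, 0; rewrite addr0 sub0mx /wt (br0r Hlie) scaler0.
- move=> [x1 [x2 [-> wx fx]]] [y1 [y2 [-> wy fy]]].
  exists (x1 + y1), (x2 + y2); split; first by rewrite addrACA.
    by rewrite /wt (brDr Hlie) wx wy scalerDr.
  by rewrite addmx_sub.
case: (ltngtP j i) ji => // [ji _|-> _].
  exists 0, x; rewrite add0r /wt (br0r Hlie) scaler0; split => //.
  exact: wt_fil wx.
by exists x, 0; rewrite addr0 sub0mx.
Qed.

Lemma fil_le i j : (i <= j)%N -> (fil j <= fil i)%MS.
Proof.
move=> ij; apply/sumsmx_subP => k jk; apply: (sumsmx_sup k) => //.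
exact: leq_trans jk.
Qed.

Lemma fil5 x : (x <= fil 5)%MS -> x = 0.
Proof.
move: x; apply: fil_ind => // [x y -> ->|i x i5 i5']; first by rewrite addr0.
by rewrite leqNgt i5' in i5.
Qed.

(** Weight vectors in the image of [ad br f0] are subtracted until [x] is killed by [e]: first the
    kernel of [ad(e)^2] is reached, then that of [ad(e)], where [ker_e_cubic] separates the weights
    0, 1, 2. *)
Lemma fil0 x : (x <= fil 0)%MS.
Proof.
have [ef he hf] := t0.
have efE v : br e (br f0 v) = br h0 v + br f0 (br e v).
  by rewrite (br_jacobi Hlie) ef.
have hfE v : br h0 (br f0 v) = br f0 (br h0 v) - 2%:R *: br f0 v.
  by rewrite (br_jacobi Hlie) hf (brNl Hlie) (brZl Hlie) addrC.
have ehE v : br e (br h0 v) = br h0 (br e v) - 2%:R *: br e v.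
  by rewrite (br_jacobi Hlie) (brC Hlie e h0) he (brNl Hlie) (brZl Hlie) addrC.
have eee v : br e (br e (br e v)) = 0.
  by have := mulmx0 _ v : v *m 0 = 0 :> 'rV[C]_d; rewrite -E3 !(ad_powS Hlie) ad_pow0.
have hE2 w : br h0 (br e (br e w)) = 2%:R *: br e (br e w).
  have := ad_pow_comm Hlie 2 w ef he.
  rewrite E3 !mulmx0 (br0r Hlie) add0r => /esym/eqP.
  rewrite scaler_eq0 pnatr_eq0 /= !(ad_powS Hlie) ad_pow0 subr_eq0 => /eqP //.
have E2f w : br e (br e (br f0 w)) = br f0 (br e (br e w)) +
    2%:R *: (br h0 (br e w) - br e w).
  by have := ad_pow_comm Hlie 1 w ef he; rewrite !(ad_powS Hlie) !ad_pow0 scale1r.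
have n2 : (2%:R : C) != 0 by rewrite pnatr_eq0.
have ker v : br e v = 0 -> (v <= fil 0)%MS.
  move=> ev; have h3 := ker_e_cubic ef he E3 ev.
  (* The summands are the Lagrange projections of [ad br h0] for the eigenvalues 0, 1 and 2. *)
  have -> : v = 2%:R^-1 *: (br h0 (br h0 v) - 3%:R *: br h0 v + 2%:R *: v)
     + (2%:R *: br h0 v - br h0 (br h0 v)) + 2%:R^-1 *: (br h0 (br h0 v) - br h0 v).
    by apply/rowP => j; rewrite !mxE; field.
  apply: addmx_sub; first apply: addmx_sub.
  - apply: (@wt_fil 2) => //.
    rewrite /wt (brZr Hlie) (brDr Hlie) (brBr Hlie) !(brZr Hlie) h3; row_ring.
  - apply: (@wt_fil 3) => //.
    rewrite /wt (brBr Hlie) !(brZr Hlie) h3; row_ring.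
  - apply: (@wt_fil 4) => //.
    rewrite /wt (brZr Hlie) (brBr Hlie) h3; row_ring.
have ker2 v : br e (br e v) = 0 -> (v <= fil 0)%MS.
  move=> eev; pose n := br e v.
  have en : br e n = 0 by [].
  have hhn : br h0 (br h0 n) = 3%:R *: br h0 n - 2%:R *: n.
    have Q := E2f v; rewrite eev (br0r Hlie) add0r -/n in Q.
    have := hE2 (br f0 v); rewrite Q (brZr Hlie) (brBr Hlie) scalerA mulrC -scalerA.
    by move=> /(scalerI n2)/eqP; rewrite subr_eq => /eqP ->; row_ring.
  (* [n1] and [n2'] are the parts of [n = [e, v]] of weights 1 and 2. As [e f0] multiplies them by 1
     and 2, the coefficients below turn [v] into a vector killed by [e]. *)
  have [n2' n2E] : exists y, y = br h0 n - n by eexists.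
  have [n1 n1E] : exists y, y = 2%:R *: n - br h0 n by eexists.
  have hn2 : br h0 n2' = 2%:R *: n2' by rewrite n2E (brBr Hlie) hhn; row_ring.
  have hn1 : br h0 n1 = n1 by rewrite n1E (brBr Hlie) (brZr Hlie) hhn; row_ring.
  have ehn : br e (br h0 n) = 0 by rewrite ehE en (br0r Hlie) scaler0 subr0.
  have en2 : br e n2' = 0 by rewrite n2E (brBr Hlie) ehn en subr0.
  have en1 : br e n1 = 0 by rewrite n1E (brBr Hlie) (brZr Hlie) ehn en scaler0 subr0.
  have -> : v = br f0 n1 + 2%:R^-1 *: br f0 n2' + (v - br f0 n1 - 2%:R^-1 *: br f0 n2').
    by row_ring.
  apply: addmx_sub; first apply: addmx_sub.
  - by apply: (@wt_fil 1) => //; rewrite /wt hfE hn1; row_ring.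
  - apply: (@wt_fil 2) => //; rewrite /wt (brZr Hlie) hfE hn2 (brZr Hlie).
    by row_ring.
  apply: ker; rewrite !(brBr Hlie) (brZr Hlie) !efE hn1 hn2 en1 en2 !(br0r Hlie) -/n.
  by rewrite !addr0 scalerA mulVf // scale1r n1E n2E; row_ring.
pose m := br e (br e x).
have em : br e m = 0 by exact: eee.
have hm : br h0 m = 2%:R *: m by exact: hE2.
have efm : br e (br f0 m) = 2%:R *: m by rewrite efE hm em (br0r Hlie) addr0.
have hfm : br h0 (br f0 m) = 0 by rewrite hfE hm (brZr Hlie) subrr.
have effm : br e (br f0 (br f0 m)) = 2%:R *: br f0 m.
  by rewrite efE hfm efm (brZr Hlie) add0r.
(* [e^2 f0^2 m = 4 m] for [m = e^2 x]. *)
have -> : x = 4%:R^-1 *: br f0 (br f0 m) + (x - 4%:R^-1 *: br f0 (br f0 m)).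
  by row_ring.
apply: addmx_sub.
  apply: (@wt_fil 0) => //; rewrite /wt (brZr Hlie) hfE hfm (br0r Hlie).
  by row_ring.
apply: ker2; rewrite !(brBr Hlie) !(brZr Hlie) effm (brZr Hlie) efm -/m.
by apply/rowP => j; rewrite !mxE; field.
Qed.

Variable theta : 'rV[C]_d -> 'rV[C]_d.
Hypothesis Htheta : cartan_conj br theta.

Lemma wt_kil i j x y : wt i x -> wt j y -> (i + j)%N != 4%N -> kil x y = 0.
Proof.
move=> wx wy ij; apply: (kil_weight Hlie wx wy).
have -> : i%:R - 2%:R + (j%:R - 2%:R) = (i + j)%:R - 4%:R :> C by rewrite natrD; ring.
by rewrite subr_eq0 eqr_nat.
Qed.

Lemma fil_kil j k x y : (4 < j + k)%N -> (x <= fil j)%MS -> (y <= fil k)%MS ->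
  kil x y = 0.
Proof.
move=> jk xj; move: y; apply: fil_ind => [|y z|b y kb _ wy].
- by rewrite kil0r.
- by rewrite kilDr // => -> ->; rewrite addr0.
move: x xj; apply: fil_ind => [|x z|a x ja _ wx].
- by rewrite kil0l.
- by rewrite kilDl // => -> ->; rewrite addr0.
apply: (wt_kil wx wy); rewrite neq_ltn; apply/orP; right.
by apply: leq_trans jk _; rewrite leq_add.
Qed.

(** Raises [m] one step at a time. The component [y1] of lowest weight can pair only with shifted
    weight [4 - m]; such vectors lie in [fil j], hence are orthogonal to [y], and to [y2] by
    [fil_kil]. *)
Lemma fil_kil_orth j y : (j <= 5)%N -> (forall z, (z <= fil j)%MS -> kil y z = 0) ->
  (y <= fil (5 - j))%MS.
Proof.
move=> j5 yj; suff h m : (m <= 5 - j)%N -> (y <= fil m)%MS by apply: h.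
elim: m => [|m IH] mj; first exact: fil0.
have m5 : (m < 5)%N by apply: leq_trans mj _; rewrite leq_subr.
have [y1 [y2 [yE w1 f2]]] := fil_succ (IH (ltnW mj)) m5.
suff y10 : y1 = 0 by rewrite yE y10 add0r.
apply: (kil_nondeg Htheta) => z; have := fil0 z; move: z.
apply: fil_ind => [|z z'|b z _ b5 wz].
- by rewrite kil0r.
- by rewrite kilDr // => -> ->; rewrite addr0.
case: (eqVneq (m + b)%N 4%N) => [mb|mb]; last exact: wt_kil w1 wz mb.
have -> : y1 = y - y2 by rewrite yE addrK.
rewrite kilBl // yj; last by apply: wt_fil wz => //; lia.
by rewrite (fil_kil _ f2 (wt_fil (leqnn b) b5 wz)) ?subrr //; lia.
Qed.

(** Weights add, and the shift by 2 is then counted twice. A bracket of weight above 2 is orthogonal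
    to all weight vectors, hence zero. *)
Lemma fil_br i j x y : (2 <= i + j)%N -> (x <= fil i)%MS -> (y <= fil j)%MS ->
  (br x y <= fil (i + j - 2))%MS.
Proof.
move=> ij xi; move: y; apply: fil_ind => [|y z|b y jb b5 wy].
- by rewrite (br0r Hlie) sub0mx.
- by rewrite (brDr Hlie); exact: addmx_sub.
move: x xi; apply: fil_ind => [|x z|a x ia a5 wx].
- by rewrite (br0l Hlie) sub0mx.
- by rewrite (brDl Hlie); exact: addmx_sub.
have w : wt (a + b - 2) (br x y).
  rewrite /wt (br_weight Hlie wx wy); congr (_ *: _).
  by rewrite natrB ?natrD; [ring|lia].
case: (leqP (a + b - 2) 4) => ab; first by apply: wt_fil w => //; lia.
suff -> : br x y = 0 by rewrite sub0mx.
apply: (kil_nondeg Htheta) => z; have := fil0 z; move: z.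
apply: fil_ind => [|z z'|c z _ c5 wz].
- by rewrite kil0r.
- by rewrite kilDr // => -> ->; rewrite addr0.
by apply: wt_kil w wz _; lia.
Qed.

Lemma fil_h0 j x : (x <= fil j)%MS -> (br h0 x - (j%:R - 2%:R) *: x <= fil j.+1)%MS.
Proof.
move: x; apply: fil_ind => [|x y hx hy|i x ji i5 wx].
- by rewrite (br0r Hlie) scaler0 subr0 sub0mx.
- have -> : br h0 (x + y) - (j%:R - 2%:R) *: (x + y) =
     (br h0 x - (j%:R - 2%:R) *: x) + (br h0 y - (j%:R - 2%:R) *: y).
    by rewrite (brDr Hlie); row_ring.
  exact: addmx_sub.
rewrite wx -scalerBl opprB addrA subrK.
case: (ltngtP j i) ji => // [ij _|-> _]; last by rewrite subrr scale0r sub0mx.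
by apply: scalemx_sub; exact: wt_fil wx.
Qed.

(* The self-adjoint neutral element is [h0] minus its orthogonal projection to [fil 3].
   Both [h] and [- theta h] act as [j - 2] on [fil j / fil (j + 1)]: the latter because
   [h] preserves the opposite filtration [theta (fil j)], the orthogonal of
   [fil (5 - j)].  So [h + theta h] is nilpotent and skew-adjoint, hence zero. *)
Lemma neutral_selfadjoint : exists h, (h - h0 <= fil 3)%MS /\ theta h = - h.
Proof.
have [u' [h [h0E u'3 horth]]] := orth_decomposition Hlie Htheta (fil 3) h0.
have hu : h - h0 = - u' by rewrite h0E opprD addrCA subrr addr0.
have u3 : (h - h0 <= fil 3)%MS by rewrite hu eqmx_opp.
(* [h] is orthogonal to [theta z] for [z] in [fil 3]; conjugating, [theta h] is orthogonal to
   [fil 3], so it lies in [fil 2], the nonnegative weights. *)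
have th2 : (theta h <= fil 2)%MS.
  apply: (@fil_kil_orth 3) => // z z3.
  by apply/eqP; rewrite -conjC_eq0 -(kil_thetar Htheta) horth.
have hfil j x : (x <= fil j)%MS -> (br h x - (j%:R - 2%:R) *: x <= fil j.+1)%MS.
  move=> xj; have -> : br h x - (j%:R - 2%:R) *: x =
      (br h0 x - (j%:R - 2%:R) *: x) + br (h - h0) x.
    by rewrite (brBl Hlie); row_ring.
  apply: addmx_sub; first exact: fil_h0.
  by have := fil_br (isT : 2 <= 3 + j)%N u3 xj; rewrite addSn subSS addSn subSS.
have thfil j x : (x <= fil j)%MS -> (br (theta h) x <= fil j)%MS.
  by move=> xj; have := fil_br (isT : 2 <= 2 + j)%N th2 xj; rewrite addKn.
have thfilS j x : (j < 5)%N -> (x <= fil j)%MS ->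
    ((br (theta h) x + (j%:R - 2%:R) *: x)%R <= fil j.+1)%MS.
  move=> j5 xj; pose y := theta x.
  (* Modulo [fil j.+1], [x] is [theta y1] with [y1] in [fil (4 - j)], where [hfil] computes the
     action of [h]. *)
  have [y1 [y2 [yE y14 y2orth]]] := orth_decomposition Hlie Htheta (fil (4 - j)) y.
  have ty2 : (theta y2 <= fil j.+1)%MS.
    have -> : j.+1 = (5 - (4 - j))%N by lia.
    apply: fil_kil_orth => [|z z4]; first by lia.
    by apply/eqP; rewrite -conjC_eq0 -(kil_thetar Htheta) y2orth.
  have xE : x = theta y1 + theta y2.
    by rewrite -(thetaD Htheta) -yE (thetaK Htheta).
  have ty1 : (theta y1 <= fil j)%MS.
    have -> : theta y1 = x - theta y2 by rewrite xE addrK.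
    rewrite addmx_sub // eqmx_opp; apply: submx_trans ty2 _; exact: fil_le.
  (* [hfil] puts this vector in [fil (5 - j)] and its conjugate lies in [fil j]; these two are
     orthogonal by [fil_kil], so definiteness applies. *)
  have v0 : br h y1 + (j%:R - 2%:R) *: y1 = 0.
    apply: (kil_theta_eq0 Htheta); rewrite kilC //.
    apply: (@fil_kil j (5 - j)); first by lia.
      rewrite (thetaD Htheta) (theta_br Htheta) (thetaZ Htheta).
      by rewrite addmx_sub ?scalemx_sub // thfil.
    have := hfil _ _ y14; have -> : (4 - j).+1 = (5 - j)%N by lia.
    have -> // : br h y1 - ((4 - j)%:R - 2%:R) *: y1 = br h y1 + (j%:R - 2%:R) *: y1.
    by rewrite natrB; [row_ring|lia].
  rewrite [X in (X <= _)%MS](_ : _ = theta (br h y1 + (j%:R - 2%:R) *: y1) +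
      (br (theta h) (theta y2) + (j%:R - 2%:R) *: theta y2)); last first.
    rewrite xE (thetaD Htheta) (theta_br Htheta) (thetaZ Htheta) (brDr Hlie).
    by rewrite rmorphB /= !conjC_nat; row_ring.
  by rewrite v0 (theta0 Htheta) add0r addmx_sub ?scalemx_sub // thfil.
pose s := h + theta h.
have sfil j x : (j < 5)%N -> (x <= fil j)%MS -> (br s x <= fil j.+1)%MS.
  move=> j5 xj; have -> : br s x = (br h x - (j%:R - 2%:R) *: x) +
      (br (theta h) x + (j%:R - 2%:R) *: x).
    by rewrite (brDl Hlie); row_ring.
  by apply: addmx_sub; [exact: hfil|exact: thfilS].
have s5 : ad br s ^+ 5 = 0.
  apply: mx_rowP => x; rewrite mulmx0; apply: fil5.
  suff h5 m : (m <= 5)%N -> (x *m ad br s ^+ m <= fil m)%MS by apply: h5.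
  elim: m => [|m IH] m5; first exact: fil0.
  by rewrite (ad_powS Hlie); apply: sfil => //; apply: IH; exact: ltnW.
have ths : theta s = s by rewrite (thetaD Htheta) (thetaK Htheta) addrC.
have s0 : s = 0.
  apply: (kil_theta_eq0 Htheta); rewrite ths /killing.
  apply: (@trace_nilpotent _ _ _ 5).
  have -> : ad br s *m ad br s = ad br s ^+ 2 by rewrite expr2.
  by rewrite -exprM mulnC exprM s5 expr0n.
exists h; split => //; apply/eqP; rewrite -addr_eq0 addrC; exact/eqP.
Qed.

Lemma sl2_triple_selfadjoint : exists h f, sl2_triple br e h f /\ theta h = - h.
Proof.
have [h [hu th]] := neutral_selfadjoint; have [ef he hf] := t0.
have e4 : (e <= fil 4)%MS.
  by apply: (@wt_fil 4) => //; rewrite /wt he; congr (_ *: _); ring.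
have eu u : (u <= fil 3)%MS -> br e u = 0.
  by move=> u3; apply: fil5; exact: (fil_br (isT : 2 <= 4 + 3)%N e4 u3).
have he' : br h e = 2%:R *: e.
  have -> : h = h0 + (h - h0) by rewrite addrC subrK.
  by rewrite (brDl Hlie) he (brC Hlie (h - h0)) eu // subr0.
have [w wE] : exists w, h - h0 = br e w.
  move: (h - h0) hu => u.
  apply: (@fil_ind (fun u => exists w, u = br e w) 3).
  - by exists 0; rewrite (br0r Hlie).
  - by move=> x y [w ->] [w' ->]; exists (w + w'); rewrite (brDr Hlie).
  (* For [x] killed by [e], [e f0 x = h0 x = (i - 2) x], and [i - 2] is nonzero as [i >= 3]. *)
  move=> i x i3 i5 wx; exists ((i%:R - 2%:R)^-1 *: br f0 x).
  have i2 : (i%:R - 2%:R : C) != 0 by rewrite subr_eq0 eqr_nat; lia.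
  have ex : br e x = 0 by apply: eu; exact: wt_fil wx.
  rewrite (brZr Hlie) (br_jacobi Hlie) ef ex (br0r Hlie) addr0 wx.
  by rewrite scalerA mulVf // scale1r.
have ef' : br e (f0 + w) = h by rewrite (brDr Hlie) ef -wE addrC subrK.
by have [f t] := sl2_triple_complete ef' he' E3; exists h, f.
Qed.

End Filtration.

(** The component [e2] of [e] orthogonal to the image of [ad(e)^2] has [theta e2] in the kernel of
    [ad(e)^2], so [kil_double_comm] forces [e2 = 0]. *)
Lemma sl2_triple_exists (theta : 'rV[C]_d -> 'rV[C]_d) e : cartan_conj br theta ->
  ad br e ^+ 3 = 0 -> exists h f, sl2_triple br e h f /\ theta h = - h.
Proof.
move=> Htheta E3.
have [e1 [e2 [eE e1W e2orth]]] := orth_decomposition Hlie Htheta (ad br e ^+ 2) e.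
have eeW z : (br e (br e z) <= ad br e ^+ 2)%MS.
  have -> : br e (br e z) = z *m ad br e ^+ 2 by rewrite !(ad_powS Hlie) ad_pow0.
  exact: submxMl.
have eet : br e (br e (theta e2)) = 0.
  apply: (kil_nondeg Htheta) => z; rewrite !(kil_inv2 Hlie) opprK.
  by apply/eqP; rewrite -conjC_eq0 -(kil_thetar Htheta) e2orth.
have e20 : e2 = 0.
  apply: (kil_theta_eq0 Htheta); have -> : e2 = e - e1 by rewrite eE addrC addKr.
  have -> : theta (e - e1) = theta e2 by rewrite eE addrC addKr.
  rewrite kilBl // (kil_double_comm E3 eet) sub0r; move/submxP: e1W => [w ->].
  by rewrite !(ad_powS Hlie) ad_pow0 !(kil_inv2 Hlie) eet kil0r // !oppr0.
move: eE; rewrite e20 addr0 => eE; move/submxP: e1W => [w wE].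
have {}wE : e = br e (br e w) by rewrite {1}eE wE !(ad_powS Hlie) ad_pow0.
(* This choice gives [[h0, e] = 2 [e, [e, w]] = 2 e]. *)
pose f0 := - (2%:R *: w); pose h0 := br e f0.
have he : br h0 e = 2%:R *: e.
  by rewrite (brC Hlie) /h0 /f0 !(brNr Hlie) !(brZr Hlie) -wE opprK.
have [f t] := sl2_triple_complete (erefl h0) he E3.
exact: sl2_triple_selfadjoint t E3 _ Htheta.
Qed.

End Existence.

(** * Adjoint orbits over [R[i]] and their characterization by height *)

Lemma exp_ad_aut (R : realType) d (br : 'rV[R[i]]_d -> 'rV[R[i]]_d -> 'rV[R[i]]_d)
    (theta : 'rV[R[i]]_d -> 'rV[R[i]]_d) x :
  lie_algebra br -> cartan_conj br theta -> killing_aut br (expmx (ad br x)).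
Proof.
move=> Hlie Htheta; split.
- exact: (exp_ad_unit Hlie Htheta).
- exact: exp_ad_br.
- exact: exp_ad_kil.
Qed.

Theorem theorem4p23 (R : realType) (d : nat)
    (br : 'rV[R[i]]_d -> 'rV[R[i]]_d -> 'rV[R[i]]_d)
    (Hlie : lie_algebra br) (Hsimple : simple_lie br)
    (k : 'rV[R[i]]_d -> Prop) (Hk : compact_real_form br k)
    (e : 'rV[R[i]]_d) (He0 : e != 0) (Hnil : ad_nilpotent br e) :
  (moore_penrose br k (adj_orbit br e) <-> orbit_height br e 2) /\
  (orbit_height br e 2 ->
     forall e', adj_orbit br e e' ->
       exists! hf : 'rV[R[i]]_d * 'rV[R[i]]_d,
         sl2_triple br e' hf.1 hf.2 /\ in_ik k hf.1).
Proof.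
have [theta [Htheta Hik]] := compact_real_form_conj Hlie Hk.
have E3 e' : orbit_height br e' 2 -> ad br e' ^+ 3 = 0 by case=> _; apply.
have Hex e' : orbit_height br e' 2 ->
    exists h f, sl2_triple br e' h f /\ in_ik k h.
  move=> /E3/(sl2_triple_exists Hlie Htheta)[h [f [t th]]].
  by exists h, f; split => //; apply/Hik.
split; first split.
- move=> MP; apply: (moore_penrose_height Hlie Htheta He0 Hnil).
    have [h [f [t /Hik th]]] := MP e (adj_orbit_refl br e).
    by exists h, f.
  move=> x; exists (expmx (ad br x)); split.
  + exact: exp_ad_aut Hlie Htheta.
  + by move=> y xxy; rewrite expmx_deg1 !(mul_ad Hlie).
  (* [e *m expmx (ad br x)] is a point of the orbit, one generator away from [e]. *)
  have [h [f [t /Hik th]]] := MP _ (adj_orbit_step x (adj_orbit_refl br e)).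
  by exists h, f.
- by move=> He e' /(orbit_height_adj_orbit Hlie Htheta)/(_ He)/Hex.
move=> He e' /(orbit_height_adj_orbit Hlie Htheta)/(_ He) He'.
have [h [f [t ht]]] := Hex _ He'.
exists (h, f); split => // -[h' f'] /= [t' /Hik th'].
have [-> -> //] := sl2_triple_unique Hlie Htheta (E3 _ He') t t' ((Hik h).1 ht) th'.
Qed.
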